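(* Suppose $n$ is an odd integer with $t_1+t_3\leq n<t_2$, and put $K=k_1+k_2+k_3$, $N=\tfrac{n+1}{2}$. Then: (i) the $\mathfrak{BI}$-module $\mathscr M_n(x_1)\cap\mathscr M_n(x_3)$ is isomorphic to $W_1\oplus W_1$, where $W_1=E_{n-t_1-t_3}(k_1+k_2+N,\,-k_2-k_3-N,\,N)^{((-1,-1),(2\,3))}$; (ii) the $\mathfrak{BI}$-modules $\mathscr M_n(x_1)/(\mathscr M_n(x_1)\cap\mathscr M_n(x_3))$ and $\mathscr M_n/\mathscr M_n(x_3)$ are each isomorphic to $W_2\oplus W_2$, where $W_2=O_{t_3-1}(k_2,\,-K-n-1,\,k_1)^{(2\,3)}$; (iii) the $\mathfrak{BI}$-modules $\mathscr M_n(x_3)/(\mathscr M_n(x_1)\cap\mathscr M_n(x_3))$ and $\mathscr M_n/\mathscr M_n(x_1)$ are each isomorphic to $W_3\oplus W_3$, where $W_3=O_{t_1-1}(k_2,\,-K-n-1,\,k_3)^{(1\,2\,3)}$. Moreover, if $k_2\geq0$, then $W_1,W_2,W_3$ are irreducible and are isomorphic to $E_{n-t_1-t_3}(k_1+k_2+N,\,N,\,k_2+k_3+N)^{(-1,1)}$, $O_{t_3-1}(k_2,\,k_1,\,-K-n-1)$ and $O_{t_1-1}(-K-n-1,\,k_3,\,k_2)$, respectively.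
   Context: Fix real numbers $k_1,k_2,k_3$. For $i=1,2,3$ let $R_i$ be the operator on functions on $\mathbb R^3$ replacing $x_i$ by $-x_i$, and $T_if=\frac{\partial f}{\partial x_i}+k_i\frac{f-R_if}{x_i}$ (Dunkl operators). Let $\sigma_1=\begin{pmatrix}0&1\\1&0\end{pmatrix}$, $\sigma_2=\begin{pmatrix}0&-\sqrt{-1}\\ \sqrt{-1}&0\end{pmatrix}$, $\sigma_3=\begin{pmatrix}1&0\\0&-1\end{pmatrix}$, and let $e_i$ act on $\mathbb C^2$ by $\sigma_i$. Tensor products are over $\mathbb R$; $\mathbb R[\cdots]_m$ denotes homogeneous polynomials of degree $m$. Let $\mathbf D=e_1\otimes T_1+e_2\otimes T_2+e_3\otimes T_3$ and $\mathscr M_n=\ker(\mathbf D|_{\mathbb C^2\otimes\mathbb R[x_1,x_2,x_3]_n})$. For $i=1,2,3$ set $t_i=-2k_i$ if $2k_i$ is an odd negative integer, and $t_i=\infty$ otherwise. For $i=1,2,3$, $\mathscr M_n(x_i)=\mathscr M_n\cap\bigoplus_{j=t_i}^n\mathbb C^2\otimes(x_i^j\cdot\mathbb R[x_p,x_q]_{n-j})$ where $\{p,q\}=\{1,2,3\}\setminus\{i\}$ (it is $\{0\}$ if $n<t_i$); it is a $\mathfrak{BI}$-submodule of $\mathscr M_n$. $\mathfrak{BI}$ is the unital associative $\mathbb C$-algebra generated by $X,Y,Z$ with relations saying that $\{X,Y\}-Z$, $\{Y,Z\}-X$, $\{Z,X\}-Y$ commute with $X,Y,Z$ ($\{A,B\}=AB+BA$).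 $\mathscr M_n$ is a $\mathfrak{BI}$-module via $X=(\sqrt{-1}\,e_1\otimes(x_3T_2-x_2T_3)+\tfrac12)R_2R_3+k_2R_3+k_3R_2$, $Y=(\sqrt{-1}\,e_2\otimes(x_1T_3-x_3T_1)+\tfrac12)R_1R_3+k_3R_1+k_1R_3$, $Z=(\sqrt{-1}\,e_3\otimes(x_2T_1-x_1T_2)+\tfrac12)R_1R_2+k_1R_2+k_2R_1$, operators composed right to left, $R_i$ acting on the polynomial factor. Twisting: for a $\mathfrak{BI}$-module $V$ and algebra automorphism $\varepsilon$, $V^\varepsilon$ is $V$ with action $x\cdot v=\varepsilon(x)v$. Write $(W_1,W_2,W_3)=(X,Y,Z)$ for the generators. A permutation $\sigma\in\mathfrak S_3$ denotes the automorphism sending the generator with index $i$ to the generator with index $\sigma(i)$; the sign automorphisms are $(1,-1)\colon X\mapsto X,Y\mapsto -Y,Z\mapsto -Z$; $(-1,1)\colon X\mapsto -X,Y\mapsto Y,Z\mapsto -Z$; $(-1,-1)\colon X\mapsto -X,Y\mapsto -Y,Z\mapsto Z$; a pair $(\epsilon,\sigma)$ denotes the composite $\epsilon\circ\sigma$. For $a,b,c\in\mathbb C$ and an integer $d\geq0$, let $\theta_i=\frac{(-1)^i(2a-d+2i)}{2}$, $\theta^*_i=\frac{(-1)^i(2b-d+2i)}{2}$ ($0\le i\le d$). For odd $d$, $E_d(a,b,c)$ is the $\mathfrak{BI}$-module $\mathbb C^{d+1}$ in which, w.r.t. a basis $v_0,\dots,v_d$, $X$ acts by the lower bidiagonal matrix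 with diagonal $(\theta_i)$ and subdiagonal entries $1$, $Y$ by the upper bidiagonal matrix with diagonal $(\theta^*_i)$ and superdiagonal $(\varphi_1,\dots,\varphi_d)$ with $\varphi_i=i(d-i+1)$ ($i$ even), $\varphi_i=c^2-\frac{(2a+2b-d+2i-1)^2}{4}$ ($i$ odd), and $Z=\{X,Y\}-\big(c^2-a^2-b^2+\frac{(d+1)^2}{4}\big)$. For even $d$, $O_d(a,b,c)$ is defined in the same way but with $\varphi_i=\frac{i(d+1-2i-2a-2b-2c)}{2}$ ($i$ even), $\varphi_i=\frac{(i-d-1)(d+1-2i-2a-2b+2c)}{2}$ ($i$ odd), and $Z=\{X,Y\}-(2ab-c(d+1))$. *)

(* Defs.v *)
From HB Require Import structures.
From mathcomp Require Import all_boot all_order all_algebra.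
From mathcomp Require Import mpoly.
From mathcomp Require Import complex.
From mathcomp Require Import reals.

Set Implicit Arguments.
Unset Strict Implicit.
Unset Printing Implicit Defensive.

Import GRing.Theory Num.Theory.
Local Open Scope ring_scope.

Definition I1 : 'I_3 := @Ordinal 3 0 isT.
Definition I2 : 'I_3 := @Ordinal 3 1 isT.
Definition I3 : 'I_3 := @Ordinal 3 2 isT.

Section Defs.
Variable R : realType.
Local Notation C := (R[i]).
Local Notation P := {mpoly C[3]}.

(* C^2 (x)_R R[x1,x2,x3]  is identified with  C[x1,x2,x3]^2 :
   an element is a pair (p1,p2), i.e. eps_1 (x) p1 + eps_2 (x) p2. *)
Definition V := (P * P)%type.

Definition kC (k : R) : C := (k%:C)%C.

Definition kvec (k1 k2 k3 : R) (i : 'I_3) : R :=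
  if i == I1 then k1 else if i == I2 then k2 else k3.

Definition refl (i : 'I_3) (p : P) : P :=
  p \mPo [tuple (if j == i then - 'X_j else 'X_j) | j < 3].

(* exact division by x_i (applied below only to polynomials f - R_i f,
   all of whose monomials contain x_i, so that  x_i * divX i g = g) *)
Definition divX (i : 'I_3) (p : P) : P :=
  \sum_(m <- msupp p | (0 < m i)%N) p@_m *: 'X_[m - U_(i)].

Definition dunkl (k : 'I_3 -> R) (i : 'I_3) (p : P) : P :=
  mderiv i p + kC (k i) *: divX i (p - refl i p).

Definition mx2 (a b c d : C) : 'M[C]_2 :=
  \matrix_(r < 2, s < 2)
    if (r : nat) == 0%N then (if (s : nat) == 0%N then a else b)
    else (if (s : nat) == 0%N then c else d).

Definition sigma (i : 'I_3) : 'M[C]_2 :=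
  if i == I1 then mx2 0 1 1 0
  else if i == I2 then mx2 0 (- 'i%C) 'i%C 0
  else mx2 1 0 0 (-1).

Definition actC2 (S : 'M[C]_2) (v : V) : V :=
  (S 0 0 *: v.1 + S 0 1 *: v.2, S 1 0 *: v.1 + S 1 1 *: v.2).

Definition liftP (L : P -> P) (v : V) : V := (L v.1, L v.2).

Definition etens (i : 'I_3) (L : P -> P) (v : V) : V := actC2 (sigma i) (liftP L v).

Definition Rop (i : 'I_3) : V -> V := liftP (refl i).

Definition Dop (k : 'I_3 -> R) (v : V) : V :=
  etens I1 (dunkl k I1) v + etens I2 (dunkl k I2) v + etens I3 (dunkl k I3) v.

Definition angular (k : 'I_3 -> R) (a b : 'I_3) (p : P) : P :=
  'X_a * dunkl k b p - 'X_b * dunkl k a p.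

Definition Xop (k : 'I_3 -> R) (v : V) : V :=
  let w := Rop I2 (Rop I3 v) in
  ('i%C *: etens I1 (angular k I3 I2) w + 2^-1 *: w)
  + kC (k I2) *: Rop I3 v + kC (k I3) *: Rop I2 v.

Definition Yop (k : 'I_3 -> R) (v : V) : V :=
  let w := Rop I1 (Rop I3 v) in
  ('i%C *: etens I2 (angular k I1 I3) w + 2^-1 *: w)
  + kC (k I3) *: Rop I1 v + kC (k I1) *: Rop I3 v.

Definition Zop (k : 'I_3 -> R) (v : V) : V :=
  let w := Rop I1 (Rop I2 v) in
  ('i%C *: etens I3 (angular k I2 I1) w + 2^-1 *: w)
  + kC (k I1) *: Rop I2 v + kC (k I2) *: Rop I1 v.

Definition BIop (k : 'I_3 -> R) (i : 'I_3) : V -> V :=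
  if i == I1 then Xop k else if i == I2 then Yop k else Zop k.

Definition Mn (k : 'I_3 -> R) (n : nat) (v : V) : Prop :=
  v.1 \is n.-homog /\ v.2 \is n.-homog /\ Dop k v = 0.

(* "j >= t" where t = -2k if 2k is an odd negative integer, t = oo otherwise *)
Definition geT (k : R) (j : nat) : Prop :=
  exists t : nat, [/\ odd t, 2 * k = - t%:R & (t <= j)%N].

(* M_n(x_i) = M_n  /\  sum_{j = t_i}^n C^2 (x) x_i^j R[x_p,x_q]_{n-j} *)
Definition Mnx (k : 'I_3 -> R) (n : nat) (i : 'I_3) (v : V) : Prop :=
  Mn k n v /\
  (forall m, m \in msupp v.1 -> geT (k i) (m i)) /\
  (forall m, m \in msupp v.2 -> geT (k i) (m i)).

Definition setI2 (S T : V -> Prop) (v : V) : Prop := S v /\ T v.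

(* Finite-dimensional BI-modules given by the matrices of X, Y, Z
   (acting on column vectors, i.e. the matrices w.r.t. a basis).       *)

Definition theta (a : C) (d i : nat) : C :=
  (-1) ^+ i * (2 * a - d%:R + 2 * i%:R) / 2.

Definition LBmx (a : C) (d : nat) : 'M[C]_d.+1 :=
  \matrix_(r, s) if r == s then theta a d r
                 else if (r : nat) == s.+1 then 1 else 0.

Definition UBmx (b : C) (d : nat) (phi : nat -> C) : 'M[C]_d.+1 :=
  \matrix_(r, s) if r == s then theta b d r
                 else if (s : nat) == r.+1 then phi (s : nat) else 0.

Definition phiE (d : nat) (a b c : C) (i : nat) : C :=
  if odd i then c ^+ 2 - (2 * a + 2 * b - d%:R + 2 * i%:R - 1) ^+ 2 / 4
  else (i * (d - i + 1))%:R.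

Definition phiO (d : nat) (a b c : C) (i : nat) : C :=
  if odd i then (i%:R - d%:R - 1) * (d%:R + 1 - 2 * i%:R - 2 * a - 2 * b + 2 * c) / 2
  else i%:R * (d%:R + 1 - 2 * i%:R - 2 * a - 2 * b - 2 * c) / 2.

Definition gen3 m (A B Cm : 'M[C]_m) (i : 'I_3) : 'M[C]_m :=
  if i == I1 then A else if i == I2 then B else Cm.

(* E_d(a,b,c)  (meant for odd d) *)
Definition Emod (d : nat) (a b c : C) : 'I_3 -> 'M[C]_d.+1 :=
  let X := LBmx a d in
  let Y := UBmx b d (phiE d a b c) in
  gen3 X Y (X *m Y + Y *m X - (c ^+ 2 - a ^+ 2 - b ^+ 2 + (d%:R + 1) ^+ 2 / 4)%:M).

(* O_d(a,b,c)  (meant for even d) *)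
Definition Omod (d : nat) (a b c : C) : 'I_3 -> 'M[C]_d.+1 :=
  let X := LBmx a d in
  let Y := UBmx b d (phiO d a b c) in
  gen3 X Y (X *m Y + Y *m X - (2 * a * b - c * (d%:R + 1))%:M).

(* Twisting by the automorphism  eps o sigma, where sigma sends W_i to
   W_(sg i) and eps sends W_j to (s j) W_j:  on V^(eps o sigma) the
   generator W_i acts as  s (sg i) * W_(sg i). *)
Definition twist m (s : 'I_3 -> C) (sg : 'I_3 -> 'I_3) (A : 'I_3 -> 'M[C]_m) :
  'I_3 -> 'M[C]_m := fun i => s (sg i) *: A (sg i).

Definition sgn_id (i : 'I_3) : C := 1.
Definition sgn_1m1 (i : 'I_3) : C := if i == I1 then 1 else -1.
Definition sgn_m11 (i : 'I_3) : C := if i == I2 then 1 else -1.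
Definition sgn_m1m1 (i : 'I_3) : C := if i == I3 then 1 else -1.

Definition perm_id (i : 'I_3) : 'I_3 := i.
Definition perm23 (i : 'I_3) : 'I_3 :=
  if i == I2 then I3 else if i == I3 then I2 else I1.
Definition perm123 (i : 'I_3) : 'I_3 :=
  if i == I1 then I2 else if i == I2 then I3 else I1.

Definition dsum2 m (A : 'I_3 -> 'M[C]_m) : 'I_3 -> 'M[C]_(m + m) :=
  fun i => block_mx (A i) 0 0 (A i).

Definition mx_iso m (A B : 'I_3 -> 'M[C]_m) : Prop :=
  exists Q : 'M[C]_m, Q \in unitmx /\ forall i, Q *m A i = B i *m Q.

(* irreducibility: nonzero, and no invariant subspace (column space of U)
   other than 0 and the whole space *)
Definition mx_irr m (A : 'I_3 -> 'M[C]_m) : Prop :=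
  (0 < m)%N /\
  forall U : 'M[C]_m, (forall i, ((A i *m U)^T <= U^T)%MS) ->
    \rank U = 0%N \/ \rank U = m.

Definition BIhom (S : V -> Prop) (op : 'I_3 -> V -> V) m (A : 'I_3 -> 'M[C]_m)
  (f : V -> 'cV[C]_m) : Prop :=
  (forall (a : C) u v, S u -> S v -> f (a *: u + v) = a *: f u + f v) /\
  (forall i v, S v -> f (op i v) = A i *m f v).

Definition iso_sub (S : V -> Prop) (op : 'I_3 -> V -> V) m (A : 'I_3 -> 'M[C]_m)
  : Prop :=
  exists f, [/\ BIhom S op A f,
    (forall u v, S u -> S v -> f u = f v -> u = v) &
    (forall w, exists v, S v /\ f v = w)].

(* the quotient S / S' is isomorphic to the matrix module A, i.e. there is
   a surjective homomorphism S -> A with kernel S' *)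
Definition iso_quot (S S' : V -> Prop) (op : 'I_3 -> V -> V) m
  (A : 'I_3 -> 'M[C]_m) : Prop :=
  exists f, [/\ BIhom S op A f,
    (forall v, S v -> (f v = 0 <-> S' v)) &
    (forall w, exists v, S v /\ f v = w)].

End Defs.

Arguments sgn_id {R} i.
Arguments sgn_1m1 {R} i.
Arguments sgn_m11 {R} i.
Arguments sgn_m1m1 {R} i.

(* Main.v *)
Require Import Defs.
From HB Require Import structures.
From mathcomp Require Import all_boot all_order all_algebra.
From mathcomp Require Import mpoly complex reals ring zify.
Set Implicit Arguments.
Unset Strict Implicit.
Unset Printing Implicit Defensive.
Import GRing.Theory Num.Theory.
Local Open Scope ring_scope.

(** Since [T_2] kills no [x_2^b] with [0 < b <= n], the equation [D v = 0] can be
    solved by recursion on the exponent of [x_2], so that [M_n] is identified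
    with [C^2 (x) C[x_1, x_3]_n] by restriction to [x_2 = 0].  There [e_2]
    commutes with the algebra, and on each of its two eigenspaces [X] and [Z]
    act on the monomials [x_1^a x_3^c] by bidiagonal matrices of opposite type.
    The entries linking [a] to [a-1] (resp. [c] to [c-1]) vanish exactly at
    [a = t_1] (resp. [c = t_3]), and the three blocks so delimited are [W_1],
    [W_2], [W_3] after rescaling the basis.

    For irreducibility, take in an invariant subspace a nonzero vector of
    minimal top index: it is an eigenvector of the upper bidiagonal generator
    [B], and a combination [A +- C + mu] lowers its top index by exactly one as
    long as some explicit product does not vanish.  The isomorphisms between
    twisted modules come from an explicit common eigenvector of [A + B] and
    [C], which generates the target. *)

(** * Bidiagonal modules *)

(** In [Emod] and [Omod] the generator Z is tridiagonal, so the effect of permuting the generators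
    cannot be read off the matrices. What survives a permutation is the shape of the relations: if
    {A, B} = T + kap, then {A, T} = B + kap', where kap' is kap with the parameters b and c
    exchanged. A twisted module therefore satisfies the relations of the module with permuted
    parameters. A map out of the latter is fixed by the image of its first basis vector, which must
    be an eigenvector of the new upper generator on which the new third generator acts as a scalar
    minus the new lower one. In the old generators this asks for a common eigenvector of T and A +
    B. It can be written down because each superdiagonal entry splits into two linear factors that
    make A and B act on it coordinatewise.

    The multiplicity two comes from the two eigenvalues of e_2. Their sign multiplies both
    off-diagonal entries of X and Z, whereas after rescaling only the products of opposite entries
    matter, so both eigenspaces carry the same module. *)

Section Bidiagonal.
Variable R : realType.
Local Notation C := (R[i]).
Implicit Types (a b c kap : C) (d i : nat) (th ph f : nat -> C).

(** Vectors are handled as sequences indexed by all of [nat], so that the relations can be checked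
    without boundary rows. The truncation at [d] comes back through [entry], which is 0 beyond [d],
    and through [ph d.+1 = 0]. *)
Definition shift f i : C := if i is j.+1 then f j else 0.
Definition lseq th f i : C := th i * f i + shift f i.
Definition useq th ph f i : C := th i * f i + ph i.+1 * f i.+1.

Definition entry d (u : 'cV[C]_d.+1) i : C :=
  if (i <= d)%N then u (inord i) 0 else 0.

Lemma entry_ord d (u : 'cV[C]_d.+1) (r : 'I_d.+1) : entry u r = u r 0.
Proof. by rewrite /entry -ltnS ltn_ord inord_val. Qed.

Lemma entry_gt d (u : 'cV[C]_d.+1) i : (d < i)%N -> entry u i = 0.
Proof. by move=> di; rewrite /entry leqNgt di. Qed.

Lemma entryP d (u v : 'cV[C]_d.+1) :
  (forall i, (i <= d)%N -> entry u i = entry v i) -> u = v.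
Proof.
move=> h; apply/matrixP=> r s; rewrite ord1 -!entry_ord.
by apply: h; rewrite -ltnS.
Qed.

Lemma entryD d (u v : 'cV[C]_d.+1) i : entry (u + v) i = entry u i + entry v i.
Proof. by rewrite /entry; case: ifP; rewrite ?mxE ?addr0. Qed.

Lemma entryZ d x (u : 'cV[C]_d.+1) i : entry (x *: u) i = x * entry u i.
Proof. by rewrite /entry; case: ifP; rewrite ?mxE ?mulr0. Qed.

Lemma entryN d (u : 'cV[C]_d.+1) i : entry (- u) i = - entry u i.
Proof. by rewrite -scaleN1r entryZ mulN1r. Qed.

Lemma inord_eqS d i : (i < d)%N -> (inord i == inord i.+1 :> 'I_d.+1) = false.
Proof.
move=> id; apply/negP => /eqP /(congr1 val) /=.
by rewrite !inordK ?ltnS // 1?ltnW // => /n_Sn.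
Qed.

Lemma entry_LB a d (u : 'cV[C]_d.+1) i : (i <= d)%N ->
  entry (LBmx a d *m u) i = lseq (theta a d) (entry u) i.
Proof.
move=> id; rewrite /lseq {1 2}/entry id mxE (bigD1 (inord i)) //= !mxE eqxx.
rewrite inordK ?ltnS //; congr (_ + _).
case: i id => [|j] jd /=.
  rewrite big1 // => s hs; rewrite mxE eq_sym (negPf hs) inordK //=.
  by rewrite mul0r.
rewrite (bigD1 (inord j)) /=; last by rewrite inord_eqS.
rewrite mxE big1 => [|s /andP [hs hs']].
  rewrite eq_sym inord_eqS //.
  by rewrite !inordK ?ltnS //= 1?ltnW // eqxx mul1r addr0 /entry ltnW.
rewrite mxE eq_sym (negPf hs) inordK ?ltnS //= eqSS.
case: eqP => [js|]; last by rewrite mul0r.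
by case/eqP: hs'; apply: val_inj; rewrite /= inordK -?js // ltnS ltnW.
Qed.

Lemma entry_UB b d ph (u : 'cV[C]_d.+1) i : (i <= d)%N ->
  entry (UBmx b d ph *m u) i = useq (theta b d) ph (entry u) i.
Proof.
move=> id; rewrite /useq {1 2}/entry id mxE (bigD1 (inord i)) //= !mxE eqxx.
rewrite inordK ?ltnS //; congr (_ + _).
have [jd|jd] := ltnP i d; last first.
  rewrite entry_gt ?ltnS // mulr0 big1 // => s hs; rewrite mxE eq_sym (negPf hs).
  rewrite inordK ?ltnS //; case: eqP => [e|]; last by rewrite mul0r.
  by have := ltn_ord s; rewrite e ltnS leqNgt ltnS jd.
rewrite (bigD1 (inord i.+1)) /=; last by rewrite eq_sym inord_eqS.
rewrite mxE big1 => [|s /andP [hs hs']].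
  rewrite inord_eqS //.
  by rewrite !inordK ?ltnS // eqxx addr0 /entry jd.
rewrite mxE eq_sym (negPf hs) inordK ?ltnS //.
case: eqP => [js|]; last by rewrite mul0r.
by case/eqP: hs'; apply: val_inj; rewrite /= inordK -?js.
Qed.

Lemma eq_UB b d ph ph' : (forall i, (0 < i <= d)%N -> ph i = ph' i) ->
  UBmx b d ph = UBmx b d ph'.
Proof.
move=> h; apply/matrixP => r s; rewrite !mxE; case: eqP => // _.
case: eqP => // e; apply: h; apply/andP; split; last by rewrite -ltnS.
by rewrite e.
Qed.

(** The generator which is neither of the two bidiagonal ones; [kap] stays free so that both
    families share the lemmas below. *)
Definition third a b d ph kap : 'M[C]_d.+1 :=
  LBmx a d *m UBmx b d ph + UBmx b d ph *m LBmx a d - kap%:M.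

Definition tseq th th' ph kap f i : C :=
  lseq th (useq th' ph f) i + useq th' ph (lseq th f) i - kap * f i.

Lemma eq_lseq th f f' i :
  (forall j, (j <= i)%N -> f j = f' j) -> lseq th f i = lseq th f' i.
Proof. by move=> h; rewrite /lseq h //; case: i h => //= i h; rewrite h. Qed.

(** Row [d] of the upper operator reads the index [d.+1], where truncated and untruncated sequences
    differ: [lseq] can be nonzero there, [entry] cannot. The factor [ph d.+1 = 0] hides the
    difference. *)
Lemma eq_useq th ph f f' d i : ph d.+1 = 0 -> (i <= d)%N ->
  (forall j, (j <= d)%N -> f j = f' j) -> useq th ph f i = useq th ph f' i.
Proof.
move=> p0 id h; rewrite /useq h //; congr (_ + _).
move: id; rewrite leq_eqVlt => /orP [/eqP ->|/h -> //].
by rewrite p0 !mul0r.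
Qed.

Lemma entry_third a b d ph kap (u : 'cV[C]_d.+1) i : ph d.+1 = 0 -> (i <= d)%N ->
  entry (third a b d ph kap *m u) i
  = tseq (theta a d) (theta b d) ph kap (entry u) i.
Proof.
move=> p0 id; rewrite /third mulmxBl mulmxDl -!mulmxA mul_scalar_mx.
rewrite !entryD entryN entryZ entry_LB // entry_UB // /tseq; congr (_ + _ - _).
  by apply: eq_lseq => j ji; rewrite entry_UB // (leq_trans ji).
by apply: (eq_useq _ p0 id) => j jd; rewrite entry_LB.
Qed.

Lemma eq_tseq th th' ph kap f f' d i : ph d.+1 = 0 -> (i <= d)%N ->
  (forall j, (j <= d)%N -> f j = f' j) ->
  tseq th th' ph kap f i = tseq th th' ph kap f' i.
Proof.
move=> p0 id h; rewrite /tseq h //; congr (_ + _ - _).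
  by apply: eq_lseq => j ji; apply: (eq_useq _ p0 (leq_trans ji id)).
apply: (eq_useq _ p0 id) => j jd; apply: eq_lseq => l lj.
exact: h (leq_trans lj jd).
Qed.

Lemma theta0 a d : theta a d 0 = a - d%:R / 2.
Proof. by rewrite /theta expr0; field. Qed.

End Bidiagonal.

(** * The Bannai-Ito relations on sequences *)

Section Relations.
Variable R : realType.
Local Notation C := (R[i]).
Implicit Types (a b c : C) (d i : nat) (f : nat -> C).

(* Unlike [phiE], whose subtraction is truncated, this vanishes at d+1. *)
Definition phiE' d a b c i : C :=
  if odd i then c ^+ 2 - (2 * a + 2 * b - d%:R + 2 * i%:R - 1) ^+ 2 / 4
  else i%:R * (d%:R - i%:R + 1).

Definition kapE d a b c : C := c ^+ 2 - a ^+ 2 - b ^+ 2 + (d%:R + 1) ^+ 2 / 4.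
Definition kapO d a b c : C := 2 * a * b - c * (d%:R + 1).

Ltac bi_expand :=
  rewrite /tseq /lseq /useq /= /theta /phiE' /phiO /kapE /kapO /= ?exprS ?expr0 /=
     ?negbK.
Ltac bi_parity i :=
  rewrite -?[(-1 : C) ^+ i]signr_odd; case: (odd i) => /=; rewrite ?expr0 ?expr1.

(** The relation making {X, Z} - Y a scalar. The constant on the right is the one on the left with
    [b] and [c] exchanged, which is why the transposed twist has these two parameters exchanged. *)
Lemma lseq_tseqE d a b c f i :
  let A := lseq (theta a d) in let B := useq (theta b d) (phiE' d a b c) in
  let T := tseq (theta a d) (theta b d) (phiE' d a b c) (kapE d a b c) in
  A (T f) i + T (A f) i = B f i + kapE d a c b * f i.
Proof.
move=> A B T; rewrite /A /B /T {A B T}.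
(* The left side reaches down to index [i - 2], hence two initial cases; beyond them only the parity
   of [i] matters. *)
case: i => [|[|i]].
- by bi_expand; field.
- by bi_expand; field.
- bi_expand; bi_parity i. by field. by field.
Qed.

Lemma lseq_tseqO d a b c f i :
  let A := lseq (theta a d) in let B := useq (theta b d) (phiO d a b c) in
  let T := tseq (theta a d) (theta b d) (phiO d a b c) (kapO d a b c) in
  A (T f) i + T (A f) i = B f i + kapO d a c b * f i.
Proof.
move=> A B T; rewrite /A /B /T {A B T}.
case: i => [|[|i]].
- by bi_expand; field.
- by bi_expand; field.
- bi_expand; bi_parity i. by field. by field.
Qed.

(** The companion relation for {Y, Z} - X; the cyclic twist uses it, since there the upper
    bidiagonal matrix takes over the role of A. *)
Lemma useq_tseqO d a b c f i :
  let A := lseq (theta a d) in let B := useq (theta b d) (phiO d a b c) in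
  let T := tseq (theta a d) (theta b d) (phiO d a b c) (kapO d a b c) in
  B (T f) i + T (B f) i = A f i + kapO d b c a * f i.
Proof.
move=> A B T; rewrite /A /B /T {A B T}.
case: i => [|[|i]].
- by bi_expand; field.
- by bi_expand; field.
- bi_expand; bi_parity i. by field. by field.
Qed.
End Relations.

(** * Irreducibility and intertwiners of bidiagonal modules *)

Section Modules.
Variable R : realType.
Local Notation C := (R[i]).
Implicit Types (a b c kap : C) (d i : nat) (th ph f : nat -> C).

Lemma mulmx_ext m (M N : 'M[C]_m) : (forall u : 'cV_m, M *m u = N *m u) -> M = N.
Proof.
move=> h; apply/matrixP => r s.
by have := h (delta_mx s 0); rewrite -!colE => /colP/(_ r); rewrite !mxE.
Qed.

Definition ev d i : 'cV[C]_d.+1 := delta_mx (inord i) 0.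

Lemma entry_ev d i j : (i <= d)%N -> entry (ev d i) j = (i == j)%:R.
Proof.
move=> id; rewrite /entry; case: leqP => jd.
  rewrite mxE andbT eq_sym; congr (_%:R); congr nat_of_bool.
  by apply/eqP/eqP => [/(congr1 val)|->] //=; rewrite !inordK.
by case: eqP => // e; move: jd; rewrite -e ltnNge id.
Qed.

Lemma LB_ev a d i : (i < d)%N ->
  LBmx a d *m ev d i = theta a d i *: ev d i + ev d i.+1.
Proof.
move=> id; apply: entryP => j jd; rewrite entry_LB // entryD entryZ.
rewrite /lseq entry_ev 1?ltnW // entry_ev //.
congr (_ + _); last by case: j jd => //= j jd; rewrite entry_ev // ltnW.
by case: eqP => [->|]; rewrite ?mulr0.
Qed.

(** [ev d 0] is a cyclic vector: subtracting [theta a d i] from the lower bidiagonal matrix sends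
    [ev d i] to [ev d i.+1]. *)
Lemma LB_ind a d (P : 'cV[C]_d.+1 -> Prop) :
  (forall x u v, P u -> P v -> P (x *: u + v)) -> P 0 ->
  (forall u, P u -> P (LBmx a d *m u)) -> P (ev d 0) -> forall u, P u.
Proof.
move=> Plin P0 PA Pe.
have Pev i : (i <= d)%N -> P (ev d i).
  elim: i => // i IHi id; have hi := IHi (ltnW id).
  have -> : ev d i.+1 = - theta a d i *: ev d i + LBmx a d *m ev d i.
    by rewrite LB_ev // addrA scaleNr addNr add0r.
  exact: Plin (PA _ hi).
move=> u.
have -> : u = \sum_(r < d.+1) u r 0 *: ev d r.
  rewrite {1}(matrix_sum_delta u); apply: eq_bigr => r _.
  by rewrite big_ord1 /ev inord_val.
apply: (big_ind P) => // [x y hx hy|r _]; first by rewrite -[x]scale1r; apply: (Plin).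
by rewrite -[_ *: _]addr0; apply: (Plin) => //; apply: Pev; rewrite -ltnS.
Qed.

(** Reduces a goal to an identity for [ring] or [field], given the multiple of a known equation that
    yields it. *)
Lemma eq_lincomb (F : pzRingType) (k u v x y : F) :
  u = v -> x - y = k * (u - v) -> x = y.
Proof. by move=> ->; rewrite subrr mulr0 => /subr0_eq. Qed.

(** Up to the sign [(-1) ^+ i], the difference of the consecutive eigenvalues [theta b d i] and
    [theta b d i.-1]. *)
Definition hcoef b d i : C := 2 * b - d%:R + 2 * i%:R - 1.
(** Up to factors made of [ph i], [hcoef b d i] and the top coordinate, the coordinate of index
    [i.-1] left after lowering an eigenvector of top index [i]. *)
Definition gap a b d ph i : C :=
  (ph i.-1 - ph i.+1 - 2 * (2 * a - d%:R + 2 * i%:R - 1)) * hcoef b d i - 2 * ph i.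

Lemma top_index d (z : 'cV[C]_d.+1) : z != 0 -> exists m,
  [/\ (m <= d)%N, entry z m != 0 & forall j, (m < j)%N -> entry z j = 0].
Proof.
move=> z0.
have [l ld zl] : exists2 l, (l <= d)%N & entry z l != 0.
  case: (pickP (fun r : 'I_d.+1 => entry z r != 0)) => [r hr|h].
    by exists r; rewrite // -ltnS.
  case/eqP: z0; apply/matrixP => r s; rewrite ord1 -entry_ord mxE.
  by apply/eqP; have := h r; case: eqP.
have ub j : entry z j != 0 -> (j <= d)%N.
  by apply: contraNT; rewrite -ltnNge => /entry_gt ->.
have ex : exists j, entry z j != 0 by exists l.
case: (ex_maxnP ex ub) => m hm mmax; exists m; split; first exact: ub.
  exact: hm.
move=> j mj; apply/eqP; apply: contraTT mj => /mmax.
by rewrite leqNgt.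
Qed.

Lemma invariant_ev0 a b d ph kap (P : 'cV[C]_d.+1 -> Prop) :
  (forall x u v, P u -> P v -> P (x *: u + v)) ->
  (forall u, P u -> P (LBmx a d *m u)) ->
  (forall u, P u -> P (UBmx b d ph *m u)) ->
  (forall u, P u -> P (third a b d ph kap *m u)) ->
  ph 0%N = 0 -> ph d.+1 = 0 ->
  (forall i, (0 < i <= d)%N ->
     [/\ ph i != 0, hcoef b d i != 0 & gap a b d ph i != 0]) ->
  forall u, P u -> u != 0 -> P (ev d 0).
Proof.
move=> Plin PA PB PT ph0 phd hyp.
suff main i (y : 'cV_d.+1) : (i <= d)%N -> P y -> entry y i != 0 ->
    (forall j, (i < j)%N -> entry y j = 0) -> P (ev d 0).
  by move=> u Pu /top_index [i [id ui top]]; apply: (main i u).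
elim/ltn_ind: i y => i IHi y id Py yi ytop.
have step z : P z -> z != 0 -> (forall j, (i <= j <= d)%N -> entry z j = 0) ->
    P (ev d 0).
  move=> Pz /top_index [m [md zm top]] hz.
  have mi : (m < i)%N.
    by rewrite ltnNge; apply: contra zm => im; rewrite hz ?im.
  exact: (IHi m mi z).
case: i id yi ytop IHi step => [|i] id yi ytop _ step.
  have -> : ev d 0 = (entry y 0)^-1 *: y + 0.
    rewrite addr0; apply: entryP => j jd; rewrite entry_ev // entryZ.
    case: j jd => [|j] _; first by rewrite mulVf.
    by rewrite (ytop j.+1) ?mulr0.
  apply: (Plin) => //.
  have -> : 0 = (-1) *: y + y by rewrite scaleN1r addNr.
  exact: Plin.
have [phi_neq0 h_neq0 gap_neq0] := hyp i.+1 id.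
(* Subtracting the diagonal entry removes the top coordinate of B y. Either this gives a nonzero
   vector of smaller top index, or [y] is an eigenvector of B. *)
have [w1|w1] := eqVneq (- theta b d i.+1 *: y + UBmx b d ph *m y) 0; last first.
  apply: (step _ _ w1); first by apply: (Plin) => //; apply: PB.
  move=> j /andP[ij jd]; rewrite entryD entryZ entry_UB // /useq (ytop j.+1) //.
  move: ij; rewrite leq_eqVlt => /orP[/eqP <-|ij]; first by ring.
  by rewrite ytop //; ring.
have eqB j : (j <= d)%N -> useq (theta b d) ph (entry y) j = theta b d i.+1 * entry y j.
  move=> jd; rewrite -entry_UB // -[UBmx _ _ _ *m _](addKr (- theta b d i.+1 *: y)).
  by rewrite w1 addr0 -scaleNr opprK entryZ.
set s : C := (-1) ^+ i.+1.
have s2 : s = 1 \/ s = -1.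
  by rewrite /s -signr_odd; case: odd; [right|left]; rewrite ?expr1 ?expr0.
have thb0 : theta b d i = - s * (2 * b - d%:R + 2 * i%:R) / 2.
  by rewrite /theta /s exprS; ring.
have thb1 : theta b d i.+1 = s * (2 * b - d%:R + 2 * i.+1%:R) / 2 by [].
have thb2 : theta b d i.+2 = - s * (2 * b - d%:R + 2 * i.+2%:R) / 2.
  by rewrite /theta exprS -/s; ring.
have tha0 : theta a d i = - s * (2 * a - d%:R + 2 * i%:R) / 2.
  by rewrite /theta /s exprS; ring.
have tha1 : theta a d i.+1 = s * (2 * a - d%:R + 2 * i.+1%:R) / 2 by [].
pose A := LBmx a d; pose T := third a b d ph kap.
(* With [s = (-1)^(i+1)] the coefficient at [i+2] cancels in [A y + s T y]; [mu]
   kills the one at [i+1], and the one at [i] is a nonzero multiple of [gap]. *)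
pose mu := - (entry (A *m y) i.+1 + s * entry (T *m y) i.+1) / entry y i.+1.
pose z := mu *: y + (s *: (T *m y) + A *m y).
have Pz : P z by apply: (Plin) => //; apply: (Plin) => //; [exact: PT | exact: PA].
have zE j : (j <= d)%N -> entry z j = mu * entry y j
    + (s * tseq (theta a d) (theta b d) ph kap (entry y) j
       + lseq (theta a d) (entry y) j).
  by move=> jd; rewrite !(entryD, entryZ) entry_LB // entry_third.
have y3 : entry y i.+3 = 0 by apply: ytop; rewrite ltnW.
have yS := ytop i.+2 (leqnn _).
(* The eigenvector equation determines the two coordinates below the top. The eigenvalues involved
   differ by [s * hcoef b d i.+1] one step down and by [2 * s] two steps down, so only the first
   division needs a hypothesis. *)
have cE : entry y i = s * ph i.+1 * entry y i.+1 / hcoef b d i.+1.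
  have := eqB i (ltnW id); rewrite /useq thb0 thb1 => e.
  apply: (mulIf h_neq0); rewrite divfK //.
  by apply: (eq_lincomb (k := - s) e); rewrite /hcoef; case: s2 => ->; field.
have uE : shift (useq (theta b d) ph (entry y)) i = theta b d i.+1 * shift (entry y) i.
  case Ei : {1 3}i => [|i'] /=; first by rewrite mulr0.
  by apply: eqB; move: id; rewrite Ei => /ltnW/ltnW.
have eE : shift (entry y) i = s * ph i * entry y i / 2.
  case Ei : i => [|i'] /=; first by rewrite ph0 mulr0 !mul0r.
  have i'd : (i' <= d)%N by move: id; rewrite Ei => /ltnW/ltnW.
  have th' : theta b d i' = s * (2 * b - d%:R + 2 * i'%:R) / 2.
    by rewrite /theta /s Ei !exprS; ring.
  have := eqB _ i'd; rewrite /useq th' thb1 Ei => e.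
  by apply: (eq_lincomb (k := - s / 2) e); case: s2 => ->; field.
have zi : entry z i = ph i.+1 * entry y i.+1 * gap a b d ph i.+1 / hcoef b d i.+1 ^+ 2.
  rewrite zE ?(ltnW id) // /mu /A /T entry_LB // entry_third // /tseq /lseq /= /useq /=.
  rewrite yS uE eE cE thb0 thb1 tha0 tha1 /gap /=.
  move: h_neq0 yi; rewrite /hcoef => h_neq0 yi.
  have h' : 2 * b - d%:R + 2 * (1 + i%:R) - 1 != 0 by rewrite -mulrS.
  by case: s2 => ->; field; rewrite h' yi.
apply: (step _ Pz).
  apply: contraNneq (_ : entry z i != 0) => [->|].
    by rewrite /entry; case: ifP; rewrite ?mxE.
  by rewrite zi !mulf_neq0 // invr_neq0 // expf_neq0.
move=> j /andP[ij jd]; rewrite zE //.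
move: ij; rewrite leq_eqVlt => /orP[/eqP <-|ij].
  rewrite /mu /A /T entry_LB // entry_third //; field; exact: yi.
case: j ij jd => // j; rewrite ltnS leq_eqVlt => /orP[/eqP <-|ij] jd.
  rewrite /tseq /lseq /= /useq /= y3 yS thb1 thb2.
  by case: s2 => ->; field.
have [y0 y1 y2] : [/\ entry y j = 0, entry y j.+1 = 0 & entry y j.+2 = 0].
  by split; apply: ytop; rewrite // ltnW // ltnW.
by rewrite /tseq /lseq /= /useq /= y0 y1 y2; ring.
Qed.

Lemma ev_ext d (M N : 'M[C]_d.+1) :
  (forall i, (i <= d)%N -> M *m ev d i = N *m ev d i) -> M = N.
Proof.
move=> h; apply/matrixP => r s.
have := h s (leq_ord s); rewrite /ev inord_val -!colE => /colP/(_ r).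
by rewrite !mxE.
Qed.

(** The scalars [x], [y], [z] absorb the signs of a twist, and [iA], [iB], [iT] its permutation. *)
Lemma irreducible_third a b d ph kap (G : 'I_3 -> 'M[C]_d.+1)
    (x y z : C) (iA iB iT : 'I_3) :
  LBmx a d = x *: G iA -> UBmx b d ph = y *: G iB ->
  third a b d ph kap = z *: G iT ->
  ph 0%N = 0 -> ph d.+1 = 0 ->
  (forall i, (0 < i <= d)%N ->
     [/\ ph i != 0, hcoef b d i != 0 & gap a b d ph i != 0]) ->
  mx_irr G.
Proof.
move=> eA eB eT ph0 phd hyp; split=> // U Uinv.
have [->|U0] := eqVneq U 0; first by left; rewrite mxrank0.
right; pose P (u : 'cV[C]_d.+1) := (u^T <= U^T)%MS.
have Plin t u v : P u -> P v -> P (t *: u + v).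
  by rewrite /P linearP /= => hu hv; rewrite addmx_sub // scalemx_sub.
have PG t (l : 'I_3) u : P u -> P ((t *: G l) *m u).
  move=> hu; rewrite /P -scalemxAl linearZ /= scalemx_sub // trmx_mul.
  by apply: submx_trans (Uinv l); rewrite trmx_mul submxMr.
have P0 : P 0 by rewrite /P trmx0 sub0mx.
have : U^T != 0 by apply: contraNneq U0 => e; rewrite -[U]trmxK e trmx0.
case/rowV0Pn => v vU v0.
have Pe : P (ev d 0).
  apply: (invariant_ev0 (a := a) (b := b) (ph := ph) (kap := kap) Plin _ _ _ _ _ hyp
    (u := v^T)) => //; rewrite ?eA ?eB ?eT //.
  - by move=> u; apply: PG.
  - by move=> u; apply: PG.
  - by move=> u; apply: PG.
  - by rewrite /P trmxK.
  - by apply: contraNneq v0 => e; rewrite -[v]trmxK e trmx0.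
have Pall : forall u, P u.
  by apply: (LB_ind (a := a) Plin P0 _ Pe) => u; rewrite eA; apply: PG.
rewrite -mxrank_tr; apply/eqP; rewrite -[_ == _]/(row_full _) -sub1mx.
apply/row_subP => i; rewrite -[row i _]trmxK; exact: Pall.
Qed.

(* The intertwining relations propagate from [ev d 0], which generates the source
   under [LBmx a d]; Cayley-Hamilton closes the chain at its end. *)
Lemma hom_from_ev0 a b d ph kap rho (A B D : 'M[C]_d.+1) (w : 'cV[C]_d.+1) :
  ph d.+1 = 0 ->
  LBmx a d *m third a b d ph kap + third a b d ph kap *m LBmx a d
    = UBmx b d ph + rho%:M ->
  A *m B + B *m A = D + kap%:M -> A *m D + D *m A = B + rho%:M ->
  char_poly A = \prod_(i < d.+1) ('X - (theta a d i)%:P) ->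
  B *m w = theta b d 0 *: w ->
  D *m w = (theta a d 0 + 2 * theta a d 0 * theta b d 0 + ph 1%N - kap) *: w
           - A *m w ->
  exists Q : 'M[C]_d.+1,
    [/\ Q *m ev d 0 = w, Q *m LBmx a d = A *m Q, Q *m UBmx b d ph = B *m Q
      & Q *m third a b d ph kap = D *m Q].
Proof.
move=> phd srcAT AB AD chA Bw Dw.
(* These vectors must be the images of the [ev d i], as [ev d i] arises from [ev d 0] by the same
   product of factors LB - theta_j. *)
pose ws := fix ws i : 'cV[C]_d.+1 :=
  if i is j.+1 then A *m ws j - theta a d j *: ws j else w.
have wsd : ws d.+1 = 0.
  have wsE i : ws i = horner_mx A (\prod_(j < i) ('X - (theta a d j)%:P)) *m w.
    elim: i => [|i IHi]; first by rewrite big_ord0 rmorph1 mul1mx.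
    rewrite big_ord_recr /= mulrC rmorphM /= -mulmxA -IHi.
    by rewrite rmorphB /= horner_mx_X horner_mx_C mulmxBl mul_scalar_mx.
  by rewrite wsE -chA (Cayley_Hamilton A) mul0mx.
pose Q : 'M[C]_d.+1 := \matrix_(r, s) ws s r 0.
have Qev i : (i <= d)%N -> Q *m ev d i = ws i.
  by move=> id; rewrite -colE; apply/matrixP => r s; rewrite !mxE inordK ?ord1.
have Plin (M N : 'M[C]_d.+1) t (u v : 'cV_d.+1) :
    M *m u = N *m u -> M *m v = N *m v -> M *m (t *: u + v) = N *m (t *: u + v).
  by move=> hu hv; rewrite !mulmxDr -!scalemxAr hu hv.
have QA : Q *m LBmx a d = A *m Q.
  apply: ev_ext => r rd'; rewrite -!mulmxA Qev //.
  have := rd'; rewrite leq_eqVlt => /orP[/eqP rd|rd].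
    have -> : LBmx a d *m ev d r = theta a d r *: ev d r.
      apply: entryP => j jd; rewrite entry_LB // entryZ /lseq rd.
      rewrite entry_ev //; case: j jd => [|j] jd /=.
        by rewrite addr0; case: eqP => [->|]; rewrite ?mulr0.
      rewrite entry_ev // (gtn_eqF jd) addr0.
      by case: eqP => [<-|]; rewrite ?mulr0.
    rewrite -scalemxAr Qev // rd; apply/esym/subr0_eq.
    by rewrite -[RHS]wsd.
  by rewrite LB_ev // mulmxDr -scalemxAr !Qev // addrC
     -[RHS](subrK (theta a d r *: ws r)).
pose P (u : 'cV[C]_d.+1) := Q *m UBmx b d ph *m u = B *m Q *m u /\
            Q *m third a b d ph kap *m u = D *m Q *m u.
suff Pall : forall u, P u.
  exists Q; split => //; first exact: Qev.
    by apply: mulmx_ext => u; case: (Pall u).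
  by apply: mulmx_ext => u; case: (Pall u).
have srcAB : LBmx a d *m UBmx b d ph + UBmx b d ph *m LBmx a d
    = third a b d ph kap + kap%:M by rewrite subrK.
(* Moving S past A by the relation S A = T + t - A S costs one use of T. Intertwining S at A u thus
   needs S and T at u, which is why B and the third generator are propagated together. *)
have step (S S' T T' : 'M[C]_d.+1) t : S *m LBmx a d = T + t%:M - LBmx a d *m S ->
    S' *m A = T' + t%:M - A *m S' -> forall u : 'cV_d.+1,
    Q *m S *m u = S' *m Q *m u -> Q *m T *m u = T' *m Q *m u ->
    Q *m S *m (LBmx a d *m u) = S' *m Q *m (LBmx a d *m u).
  move=> eS eS' u hS hT.
  transitivity (T' *m Q *m u + t *: (Q *m u) - A *m (S' *m Q *m u)).
    rewrite -hS -hT -mulmxA [S *m _]mulmxA eS mulmxBl mulmxDl mul_scalar_mx.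
    rewrite mulmxBr mulmxDr -scalemxAr -(mulmxA (LBmx a d)) [Q *m (_ *m _)]mulmxA.
    by rewrite (mulmxA Q (LBmx a d)) QA !mulmxA.
  rewrite -[RHS]mulmxA (mulmxA Q (LBmx a d)) QA -(mulmxA A Q) [RHS]mulmxA eS' mulmxBl mulmxDl.
  by rewrite mul_scalar_mx !mulmxA.
apply: (LB_ind (a := a) (P := P)).
- by move=> t v v' [h1 h2] [h1' h2']; split; apply: Plin.
- by split; rewrite !mulmx0.
- move=> v [hB hT]; split.
    apply: (step _ _ _ _ kap _ _ _ hB hT); last by rewrite -AB addrC addKr.
    by rewrite -srcAB addrC addKr.
  apply: (step _ _ _ _ rho _ _ _ hT hB); last by rewrite -AD addrC addKr.
  by rewrite -srcAT addrC addKr.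
have Be : UBmx b d ph *m ev d 0 = theta b d 0 *: ev d 0.
  apply: entryP => j jd; rewrite entry_UB // entryZ /useq !entry_ev //= mulr0.
  by case: eqP => [<-|]; rewrite ?mulr0 ?addr0.
(* The first two eigenvalues of B add up to -1. This is the coefficient of [ev d 1] in the image of
   [ev d 0] under the third generator, and it produces the term - A in the condition on [w]. *)
have thS (x : C) : theta x d 1 = - theta x d 0 - 1.
  by rewrite /theta expr0 expr1; field.
have Te : third a b d ph kap *m ev d 0 =
    (theta a d 0 + 2 * theta a d 0 * theta b d 0 + ph 1%N - kap) *: ev d 0
    - LBmx a d *m ev d 0.
  apply: entryP => j jd; rewrite entry_third // entryD entryZ entryN entry_LB //.
  rewrite /tseq /lseq /useq; case: j jd => [|[|j]] jd; rewrite /= !entry_ev //=.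
  - by move: (theta a d 0) (theta b d 0) (ph 1%N) (theta a d 1) => *; ring.
  - by rewrite !thS; move: (theta a d 0) (theta b d 0) (theta a d 2) => *; ring.
  - by rewrite !(mulr0, addr0, subr0).
split; rewrite -!mulmxA Qev //= ?Be ?Te.
  by rewrite -scalemxAr Qev // Bw.
by rewrite mulmxBr -scalemxAr !mulmxA QA -mulmxA Qev // Dw.
Qed.

(** Schur's argument: the column space of [Q] is invariant under [A] and nonzero, hence everything;
    as the dimensions agree, [Q] is invertible. *)
Lemma irr_iso m (A G : 'I_3 -> 'M[C]_m) (Q : 'M[C]_m) :
  mx_irr A -> Q != 0 -> (forall l, Q *m G l = A l *m Q) -> mx_iso A G.
Proof.
move=> [_ irr] Q0 QG.
have Qu : Q \in unitmx.
  have := irr Q; case.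
  - by move=> l; rewrite -QG trmx_mul submxMl.
  - by move/eqP; rewrite mxrank_eq0 (negPf Q0).
  by move=> rQ; rewrite -row_full_unit /row_full rQ.
exists (invmx Q); split=> [|l]; first by rewrite unitmx_inv.
have <- : invmx Q *m A l *m Q = G l by rewrite -mulmxA -QG mulmxA mulVmx // mul1mx.
by rewrite mulmxK.
Qed.

Lemma char_poly_UB b d ph :
  char_poly (UBmx b d ph) = \prod_(i < d.+1) ('X - (theta b d i)%:P).
Proof.
have -> : char_poly (UBmx b d ph) = char_poly (UBmx b d ph)^T.
  rewrite /char_poly -det_tr; congr (\det _).
  by rewrite /char_poly_mx linearB /= tr_scalar_mx map_trmx.
rewrite char_poly_trig; last first.
  apply/is_trig_mxP => i j ij; rewrite !mxE -val_eqE /= (gtn_eqF ij).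
  by rewrite ltn_eqF // ltnS ltnW.
by apply: eq_bigr => i _; rewrite !mxE eqxx.
Qed.

Lemma char_poly_LB a d :
  char_poly (LBmx a d) = \prod_(i < d.+1) ('X - (theta a d i)%:P).
Proof.
rewrite char_poly_trig; last first.
  apply/is_trig_mxP => i j ij; rewrite !mxE -val_eqE /= (ltn_eqF ij).
  by rewrite ltn_eqF // ltnS ltnW.
by apply: eq_bigr => i _; rewrite !mxE eqxx.
Qed.

(* [r i] is the ratio [w_(i-1) / w_i] of the coordinates of the vector. *)
Definition ratio_vec d (r : nat -> C) : 'cV[C]_d.+1 :=
  \col_(i < d.+1) \prod_(j < i) (r j.+1)^-1.

Lemma ratio_vec_neq0 d r : ratio_vec d r != 0.
Proof.
apply/eqP => /colP/(_ ord0); rewrite !mxE big_ord0 => /eqP.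
by rewrite oner_eq0.
Qed.

(** * Common eigenvectors of A + B and the third generator *)

Section RatioVec.
Variables (d : nat) (r : nat -> C) (ph : nat -> C) (q : nat -> C) (a b kap : C).
Hypothesis r0 : r 0%N = 0.
Hypothesis rn0 : forall i, (0 < i <= d)%N -> r i != 0.
Hypothesis phE : forall i, ph i = r i * q i.
Hypothesis qd : q d.+1 = 0.

Lemma ratio_vec_shift i : (i <= d)%N ->
  shift (entry (ratio_vec d r)) i = r i * entry (ratio_vec d r) i.
Proof.
case: i => [|i] id /=; first by rewrite r0 mul0r.
rewrite /entry id ltnW // !mxE !inordK ?ltnS // 1?ltnW // big_ord_recr /= mulrC.
by rewrite mulfVK // rn0.
Qed.

Lemma ratio_vec_up i : (i <= d)%N ->
  ph i.+1 * entry (ratio_vec d r) i.+1 = q i.+1 * entry (ratio_vec d r) i.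
Proof.
rewrite leq_eqVlt => /orP[/eqP->|id].
  by rewrite entry_gt // qd mulr0 mul0r.
rewrite phE [r _ * _]mulrC -mulrA; congr (_ * _).
by have := ratio_vec_shift id; rewrite /= => ->.
Qed.

(** On this vector A multiplies coordinate [i] by [theta a d i + r i], and B by
    [theta b d i + q i.+1], so an eigenvalue of A + B is a condition on scalars. *)
Lemma LB_UB_ratio_vec s :
  (forall i, r i + q i.+1 + theta a d i + theta b d i = s) ->
  UBmx b d ph *m ratio_vec d r = s *: ratio_vec d r - LBmx a d *m ratio_vec d r.
Proof.
move=> h; apply: entryP => i id; rewrite entryD entryN entryZ entry_UB // entry_LB //.
rewrite /useq /lseq ratio_vec_up // ratio_vec_shift // -(h i); ring.
Qed.

(** The same coordinatewise rule applied twice. At [i = 0] the value of [i.-1] is harmless because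
    [r 0 = 0]. *)
Lemma third_ratio_vec e :
  (forall i, theta a d i * (theta b d i + q i.+1) + r i * (theta b d i.-1 + q i)
           + theta b d i * (theta a d i + r i) + q i.+1 * (theta a d i.+1 + r i.+1)
           - kap = e) ->
  third a b d ph kap *m ratio_vec d r = e *: ratio_vec d r.
Proof.
have phd : ph d.+1 = 0 by rewrite phE qd mulr0.
move=> h; apply: entryP => i id; rewrite entryZ entry_third //.
have lE j : (j <= d)%N -> lseq (theta a d) (entry (ratio_vec d r)) j =
    (theta a d j + r j) * entry (ratio_vec d r) j.
  by move=> jd; rewrite /lseq ratio_vec_shift // mulrDl.
have uE j : (j <= d)%N -> useq (theta b d) ph (entry (ratio_vec d r)) j =
    (theta b d j + q j.+1) * entry (ratio_vec d r) j.
  by move=> jd; rewrite /useq ratio_vec_up // mulrDl.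
have suE : shift (useq (theta b d) ph (entry (ratio_vec d r))) i =
    r i * (theta b d i.-1 + q i) * entry (ratio_vec d r) i.
  rewrite mulrAC -ratio_vec_shift //.
  case: (i) id => [|j] jd /=; first by rewrite mul0r.
  by rewrite uE 1?ltnW // mulrC.
have ulE : ph i.+1 * lseq (theta a d) (entry (ratio_vec d r)) i.+1 =
    q i.+1 * (theta a d i.+1 + r i.+1) * entry (ratio_vec d r) i.
  move: id; rewrite leq_eqVlt => /orP[/eqP->|id].
    by rewrite phd qd !mul0r.
  by rewrite lE // mulrCA ratio_vec_up 1?ltnW //; ring.
rewrite /tseq {1}/lseq uE // suE {1}/useq lE // ulE -(h i).
by move: (theta _ _ _) => *; ring.
Qed.

End RatioVec.

Lemma LB_thirdE d a b c : odd d ->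
  let A := LBmx a d in let T := third a b d (phiE' d a b c) (kapE d a b c) in
  A *m T + T *m A = UBmx b d (phiE' d a b c) + (kapE d a c b)%:M.
Proof.
move=> od A T; rewrite {}/A {}/T; have phd : phiE' d a b c d.+1 = 0.
  by rewrite /phiE' /= od /= mulrS; ring.
apply: mulmx_ext => u; apply: entryP => i id.
rewrite (mulmxDl (_ *m _)) [in RHS]mulmxDl -!mulmxA mul_scalar_mx.
rewrite 2!entryD entryZ entry_LB // entry_third //.
rewrite entry_UB // -(lseq_tseqE d a b c (entry u) i) /=; congr (_ + _).
  by apply: eq_lseq => j ji; rewrite entry_third // (leq_trans ji).
by apply: (eq_tseq _ _ _ phd id) => j jd; rewrite entry_LB.
Qed.

Lemma phiO_last d a b c : ~~ odd d -> phiO d a b c d.+1 = 0.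
Proof. by move=> ed; rewrite /phiO /= ed mulrS; ring. Qed.

Lemma LB_thirdO d a b c : ~~ odd d ->
  let A := LBmx a d in let T := third a b d (phiO d a b c) (kapO d a b c) in
  A *m T + T *m A = UBmx b d (phiO d a b c) + (kapO d a c b)%:M.
Proof.
move=> ed A T; rewrite {}/A {}/T; have phd := phiO_last a b c ed.
apply: mulmx_ext => u; apply: entryP => i id.
rewrite (mulmxDl (_ *m _)) [in RHS]mulmxDl -!mulmxA mul_scalar_mx.
rewrite 2!entryD entryZ entry_LB // entry_third //.
rewrite entry_UB // -(lseq_tseqO d a b c (entry u) i) /=; congr (_ + _).
  by apply: eq_lseq => j ji; rewrite entry_third // (leq_trans ji).
by apply: (eq_tseq _ _ _ phd id) => j jd; rewrite entry_LB.
Qed.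

Lemma UB_thirdO d a b c : ~~ odd d ->
  let B := UBmx b d (phiO d a b c) in
  let T := third a b d (phiO d a b c) (kapO d a b c) in
  B *m T + T *m B = LBmx a d + (kapO d b c a)%:M.
Proof.
move=> ed B T; rewrite {}/B {}/T; have phd := phiO_last a b c ed.
apply: mulmx_ext => u; apply: entryP => i id.
rewrite (mulmxDl (_ *m _)) [in RHS]mulmxDl -!mulmxA mul_scalar_mx.
rewrite 2!entryD entryZ entry_UB // entry_third //.
rewrite entry_LB // -(useq_tseqO d a b c (entry u) i) /=; congr (_ + _).
  by apply: (eq_useq _ phd id) => j jd; rewrite entry_third.
by apply: (eq_tseq _ _ _ phd id) => j jd; rewrite entry_UB.
Qed.

(** The linear factors of [phiO] are distributed between [rO] and [qO] so that, in both parities,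
    [rO i + qO i.+1] cancels the dependence on [i] of the two diagonal entries. *)
Definition rO d a b c i : C :=
  if odd i then - (d%:R + 1 - 2 * i%:R - 2 * a - 2 * b + 2 * c) / 2 else - i%:R.
Definition qO d a b c i : C :=
  if odd i then - (i%:R - d%:R - 1)
  else - (d%:R + 1 - 2 * i%:R - 2 * a - 2 * b - 2 * c) / 2.

Lemma phiO_ratio d a b c i : phiO d a b c i = rO d a b c i * qO d a b c i.
Proof. by rewrite /phiO /rO /qO; case: odd; field. Qed.

Lemma ratio_vecO d a b c : ~~ odd d ->
  (forall i, (0 < i <= d)%N -> rO d a b c i != 0) ->
  let w := ratio_vec d (rO d a b c) in
  UBmx b d (phiO d a b c) *m w = (a + b) *: w - LBmx a d *m w /\
  third a b d (phiO d a b c) (kapO d a b c) *m w = theta c d 0 *: w.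
Proof.
move=> ed rn0 w.
have r0 : rO d a b c 0 = 0 by rewrite /rO oppr0.
have qd : qO d a b c d.+1 = 0 by rewrite /qO /= ed mulrS; ring.
split.
  apply: (LB_UB_ratio_vec (q := qO d a b c)) => // [i|i].
    exact: phiO_ratio.
  rewrite /theta /rO /qO /= -[(-1) ^+ i]signr_odd.
  by case: (odd i); rewrite ?expr1 ?expr0 /=; field.
apply: (third_ratio_vec (q := qO d a b c)) => // [i|i].
  exact: phiO_ratio.
case: i => [|i]; first by rewrite /rO /qO /theta /kapO /=; field.
rewrite /theta /rO /qO /kapO /= !exprS !expr0 -[(-1) ^+ i]signr_odd.
by case: (odd i); rewrite ?expr1 ?expr0 /=; field.
Qed.

Definition gE d a b i : C := 2 * a + 2 * b - d%:R + 2 * i%:R - 1.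
(** At odd indices the difference of squares in [phiE'] supplies the two factors. *)
Definition rE d a b c i : C := if odd i then - (c - gE d a b i / 2) else - i%:R.
Definition qE d a b c i : C :=
  if odd i then - (c + gE d a b i / 2) else - (d%:R - i%:R + 1).

Lemma phiE_ratio d a b c i : phiE' d a b c i = rE d a b c i * qE d a b c i.
Proof. by rewrite /phiE' /rE /qE /gE; case: odd; field. Qed.

Lemma ratio_vecE d a b c : odd d ->
  (forall i, (0 < i <= d)%N -> rE d a b c i != 0) ->
  let w := ratio_vec d (rE d a b c) in
  UBmx b d (phiE' d a b c) *m w = (- c - (d%:R + 1) / 2) *: w - LBmx a d *m w /\
  third a b d (phiE' d a b c) (kapE d a b c) *m w = theta c d 0 *: w.
Proof.
move=> od rn0 w.
have r0 : rE d a b c 0 = 0 by rewrite /rE oppr0.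
have qd : qE d a b c d.+1 = 0 by rewrite /qE /= od mulrS /=; ring.
split.
  apply: (LB_UB_ratio_vec (q := qE d a b c)) => // [i|i].
    exact: phiE_ratio.
  rewrite /theta /rE /qE /gE /= -[(-1) ^+ i]signr_odd.
  by case: (odd i); rewrite ?expr1 ?expr0 /=; field.
apply: (third_ratio_vec (q := qE d a b c)) => // [i|i].
  exact: phiE_ratio.
case: i => [|i]; first by rewrite /rE /qE /gE /theta /kapE /=; field.
rewrite /theta /rE /qE /gE /kapE /= !exprS !expr0 -[(-1) ^+ i]signr_odd.
by case: (odd i); rewrite ?expr1 ?expr0 /=; field.
Qed.

Lemma UBmx_phiE a b c d :
  UBmx b d (phiE d a b c) = UBmx b d (phiE' d a b c).
Proof.
apply: eq_UB => i /andP[i0 id]; rewrite /phiE /phiE'; case: odd => //.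
by rewrite natrM natrD natrB.
Qed.

Lemma forall_I3 (P : 'I_3 -> Prop) : P I1 -> P I2 -> P I3 -> forall l, P l.
Proof.
move=> p1 p2 p3 [[|[|[|//]]] h].
- by rewrite (_ : Ordinal h = I1) //; apply: val_inj.
- by rewrite (_ : Ordinal h = I2) //; apply: val_inj.
- by rewrite (_ : Ordinal h = I3) //; apply: val_inj.
Qed.

Lemma OmodE d a b c : Omod d a b c =
  gen3 (LBmx a d) (UBmx b d (phiO d a b c)) (third a b d (phiO d a b c) (kapO d a b c)).
Proof. by []. Qed.

Lemma EmodE d a b c : Emod d a b c =
  gen3 (LBmx a d) (UBmx b d (phiE' d a b c)) (third a b d (phiE' d a b c) (kapE d a b c)).
Proof. by rewrite /Emod UBmx_phiE. Qed.

Definition admissible a b d ph := forall i, (0 < i <= d)%N ->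
  [/\ ph i != 0, hcoef b d i != 0 & gap a b d ph i != 0].

Lemma phiO0 d a b c : phiO d a b c 0 = 0.
Proof. by rewrite /phiO /= !mul0r. Qed.

Lemma rO_neq0 d a b c : admissible a b d (phiO d a b c) ->
  forall i, (0 < i <= d)%N -> rO d a b c i != 0.
Proof.
move=> h i /h [+ _ _]; rewrite phiO_ratio.
by apply: contraNneq => ->; rewrite mul0r.
Qed.

Lemma rE_neq0 d a b c : admissible a b d (phiE' d a b c) ->
  forall i, (0 < i <= d)%N -> rE d a b c i != 0.
Proof.
move=> h i /h [+ _ _]; rewrite phiE_ratio.
by apply: contraNneq => ->; rewrite mul0r.
Qed.

Lemma mulmx_ev0_neq0 d (Q : 'M[C]_d.+1) w : Q *m ev d 0 = w -> w != 0 -> Q != 0.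
Proof. by move=> <-; apply: contraNneq => ->; rewrite mul0mx. Qed.

Lemma Omod23_irr d a b c : ~~ odd d -> admissible a b d (phiO d a b c) ->
  mx_irr (twist sgn_id perm23 (Omod d a b c)).
Proof.
move=> ed h; apply: (irreducible_third (a := a) (kap := kapO d a b c) (x := 1) (y := 1) (z := 1)
  (iA := I1) (iB := I3) (iT := I2) _ _ _ (phiO0 d a b c) (phiO_last a b c ed) h);
by rewrite /twist OmodE /sgn_id !scale1r.
Qed.

Lemma Omod123_irr d a b c : ~~ odd d -> admissible a b d (phiO d a b c) ->
  mx_irr (twist sgn_id perm123 (Omod d a b c)).
Proof.
move=> ed h; apply: (irreducible_third (a := a) (kap := kapO d a b c) (x := 1) (y := 1) (z := 1)
  (iA := I3) (iB := I1) (iT := I2) _ _ _ (phiO0 d a b c) (phiO_last a b c ed) h);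
by rewrite /twist OmodE /sgn_id !scale1r.
Qed.

Lemma Emod23_irr d a b c : odd d -> admissible a b d (phiE' d a b c) ->
  mx_irr (twist sgn_m1m1 perm23 (Emod d a b c)).
Proof.
move=> od h; have p0 : phiE' d a b c 0 = 0 by rewrite /phiE' /= mul0r.
have pd : phiE' d a b c d.+1 = 0 by rewrite /phiE' /= od /= mulrS; ring.
apply: (irreducible_third (a := a) (kap := kapE d a b c) (x := -1) (y := -1) (z := 1)
  (iA := I1) (iB := I3) (iT := I2) _ _ _ p0 pd h);
by rewrite /twist EmodE /sgn_m1m1 /= ?scale1r // scalerA mulrNN mulr1 scale1r.
Qed.

Lemma Omod23_iso d a b c : ~~ odd d -> admissible a b d (phiO d a b c) ->
  mx_iso (twist sgn_id perm23 (Omod d a b c)) (Omod d a c b).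
Proof.
move=> ed h; have [Bw Tw] := ratio_vecO ed (rO_neq0 h).
set w := ratio_vec _ _ in Bw Tw.
have [|||||Q [Qe QA QB QT]] := hom_from_ev0 (A := LBmx a d)
    (B := third a b d (phiO d a b c) (kapO d a b c))
    (D := UBmx b d (phiO d a b c)) (w := w) (phiO_last _ _ _ ed) (LB_thirdO a c b ed).
- exact: LB_thirdO.
- by rewrite /third subrK.
- exact: char_poly_LB.
- exact: Tw.
- by rewrite Bw; congr (_ *: _ - _); rewrite !theta0 /phiO /kapO /=; field.
apply: (irr_iso (Omod23_irr ed h) (mulmx_ev0_neq0 Qe (ratio_vec_neq0 _ _))).
by apply: forall_I3; rewrite /twist !OmodE /sgn_id scale1r.
Qed.

(** The new lower generator is the upper bidiagonal matrix. The condition on [w] again involves A +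
    B, because the new third generator is the old A. *)
Lemma Omod123_iso d a b c : ~~ odd d -> admissible a b d (phiO d a b c) ->
  mx_iso (twist sgn_id perm123 (Omod d a b c)) (Omod d b c a).
Proof.
move=> ed h; have [Bw Tw] := ratio_vecO ed (rO_neq0 h).
set w := ratio_vec _ _ in Bw Tw.
have [|||||Q [Qe QA QB QT]] := hom_from_ev0 (A := UBmx b d (phiO d a b c))
    (B := third a b d (phiO d a b c) (kapO d a b c))
    (D := LBmx a d) (w := w) (phiO_last _ _ _ ed) (LB_thirdO b c a ed).
- exact: UB_thirdO.
- by rewrite [kapO d b a c](_ : _ = kapO d a b c) ?subrK 1?addrC ?subrK // /kapO; ring.
- exact: char_poly_UB.
- exact: Tw.
- rewrite Bw [X in X *: w - _](_ : _ = a + b) ?subKr //.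
  by rewrite !theta0 /phiO /kapO /=; field.
apply: (irr_iso (Omod123_irr ed h) (mulmx_ev0_neq0 Qe (ratio_vec_neq0 _ _))).
by apply: forall_I3; rewrite /twist !OmodE /sgn_id scale1r.
Qed.

(** The same signs occur in both twists, so the untwisted matrices are intertwined. The last
    parameter enters [phiE'] and [kapE] only through its square, which allows [- b] in the
    target. *)
Lemma Emod23_iso d a b c : odd d -> admissible a b d (phiE' d a b c) ->
  mx_iso (twist sgn_m1m1 perm23 (Emod d a b c))
         (twist sgn_m11 perm_id (Emod d a c (- b))).
Proof.
move=> od h; have [Bw Tw] := ratio_vecE od (rE_neq0 h).
set w := ratio_vec _ _ in Bw Tw.
have pd : phiE' d a c (- b) d.+1 = 0 by rewrite /phiE' /= od /= mulrS; ring.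
have [|||||Q [Qe QA QB QT]] := hom_from_ev0 (A := LBmx a d)
    (B := third a b d (phiE' d a b c) (kapE d a b c))
    (D := UBmx b d (phiE' d a b c)) (w := w) pd (LB_thirdE a c (- b) od).
- have -> : kapE d a c (- b) = kapE d a c b by rewrite /kapE; ring.
  exact: LB_thirdE.
- have -> : kapE d a (- b) c = kapE d a b c by rewrite /kapE; ring.
  by rewrite subrK.
- exact: char_poly_LB.
- exact: Tw.
- by rewrite Bw; congr (_ *: _ - _); rewrite !theta0 /phiE' /kapE /=; field.
apply: (irr_iso (Emod23_irr od h) (mulmx_ev0_neq0 Qe (ratio_vec_neq0 _ _))).
by apply: forall_I3; rewrite /twist !EmodE /sgn_m1m1 /sgn_m11 /= -scalemxAr -scalemxAl
  ?QA ?QB ?QT.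
Qed.

End Modules.

Arguments ev {R} d i.

(** * Coefficients of the Dunkl operators *)

Section Coefficients.
Variable R : realType.
Local Notation C := (R[i]).
Local Notation P := {mpoly C[3]}.
Implicit Types (p q : P) (v : V R) (m : 'X_{1..3}) (k : 'I_3 -> R).

(** The factor by which the Dunkl operator sends x_i^j to x_i^(j-1). *)
Definition lam (x : R) j : C := j%:R + (odd j)%:R * (2 * kC x).

Definition mn a b c : 'X_{1..3} := [multinom [tuple a; b; c]].

Lemma mnE a b c : (mn a b c I1 = a) * (mn a b c I2 = b) * (mn a b c I3 = c).
Proof. by rewrite /mn !multinomE !(tnth_nth 0%N). Qed.

Lemma mn_ext m m' : m I1 = m' I1 -> m I2 = m' I2 -> m I3 = m' I3 -> m = m'.
Proof. by move=> h1 h2 h3; apply/mnmP; apply: forall_I3. Qed.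

Lemma mn_id m : m = mn (m I1) (m I2) (m I3).
Proof. by apply: mn_ext; rewrite mnE. Qed.

Lemma mnU1 a b c : (mn a b c + U_(I1) = mn a.+1 b c)%MM.
Proof. by apply: mn_ext; rewrite mnmDE !mnE mnm1E /= ?addn1 ?addn0. Qed.

Lemma mnU2 a b c : (mn a b c + U_(I2) = mn a b.+1 c)%MM.
Proof. by apply: mn_ext; rewrite mnmDE !mnE mnm1E /= ?addn1 ?addn0. Qed.

Lemma mnU3 a b c : (mn a b c + U_(I3) = mn a b c.+1)%MM.
Proof. by apply: mn_ext; rewrite mnmDE !mnE mnm1E /= ?addn1 ?addn0. Qed.

Lemma mdeg_mn a b c : mdeg (mn a b c) = (a + b + c)%N.
Proof.
rewrite mdegE !big_ord_recr big_ord0 /= add0n; congr (_ + _ + _)%N;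
by rewrite /mn multinomE (tnth_nth 0%N).
Qed.

Lemma mcoeff_refl l p m : (refl l p)@_m = (-1) ^+ m l * p@_m.
Proof.
rewrite /refl [in RHS](mpolyE p) comp_mpolyEX !raddf_sum /= mulr_sumr.
apply: eq_bigr => m' _; rewrite !mcoeffZ mcoeffX mulrCA; congr (_ * _).
rewrite comp_mpolyX.
have -> : \prod_(j < 3) tnth [tuple (if j == l then - 'X_j else 'X_j) | j < 3] j ^+ m' j
   = ((-1) ^+ m' l)%:MP * 'X_[m'] :> P.
  rewrite mpolyXE_id (eq_bigr (fun j => (if j == l then ((-1) ^+ m' l)%:MP else 1)
     * 'X_j ^+ m' j)) => [|j _].
    by rewrite big_split /= -big_mkcond big_pred1_eq.
  rewrite tnth_mktuple; case: eqP => [->|]; last by rewrite mul1r.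
  rewrite [LHS]exprNn -signr_odd -[in RHS]signr_odd.
  by case: odd; rewrite ?expr1 ?expr0 ?mpolyCN ?mpolyC1.
rewrite mcoeffCM mcoeffX; case: eqP => [->|]; by rewrite ?mulr0.
Qed.

Lemma mcoeff_divX l p m : (divX l p)@_m = p@_(m + U_(l)).
Proof.
rewrite /divX raddf_sum /= [in RHS](mpolyE p) raddf_sum /= big_mkcond /=.
apply: eq_bigr => m' _; rewrite !mcoeffZ !mcoeffX.
case: ifP => h.
  congr (_ * _%:R); congr nat_of_bool.
  apply/eqP/eqP => [<-|->]; last by rewrite addmK.
  by rewrite submK //; apply/mnm_lepP => j; rewrite mnm1E; case: eqP => // <-.
case: eqP => [e|]; rewrite ?mulr0 //.
by move: h; rewrite e mnmDE mnm1E eqxx addn1.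
Qed.

Lemma mcoeff_dunkl k l p m :
  (dunkl k l p)@_m = lam (k l) (m l).+1 * p@_(m + U_(l)).
Proof.
rewrite /dunkl mcoeffD mcoeffZ mcoeff_deriv mcoeff_divX mcoeffB mcoeff_refl.
rewrite mnmDE mnm1E eqxx addn1 /lam -mulr_natl -signr_odd /=.
by case: (odd (m l)); rewrite /= ?expr0 ?expr1; ring.
Qed.

Lemma mcoeff_mulX l p m : ('X_l * p)@_(m + U_(l)) = p@_m.
Proof. by rewrite mulrC addmC mcoeffMX. Qed.

Lemma mcoeff_mulX0 l p m : m l = 0%N -> ('X_l * p)@_m = 0.
Proof.
move=> ml; rewrite (mpolyE p) mulr_sumr raddf_sum big1 // => m' _ /=.
rewrite -scalerAr mcoeffZ -mpolyXD mcoeffX; case: eqP => [e|]; rewrite ?mulr0 //.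
by move: ml; rewrite -e mnmDE mnm1E eqxx.
Qed.

(* Coordinate of [v] along the eigenvector of e_2 of eigenvalue (-1)^s. *)
Definition ucf v (s : bool) a b c : C :=
  v.1@_(mn a b c) - (-1) ^+ s * 'i%C * v.2@_(mn a b c).

Lemma etensE l (L : P -> P) v : etens l L v =
  if l == I1 then (L v.2, L v.1)
  else if l == I2 then (- 'i%C *: L v.2, 'i%C *: L v.1) else (L v.1, - L v.2).
Proof.
move: l; apply: forall_I3;
rewrite /etens /actC2 /sigma /mx2 /= !mxE /= ?scale0r ?scale1r ?add0r ?addr0 //.
by rewrite scaleN1r.
Qed.

End Coefficients.

(** * The kernel of D and its restriction to x_2 = 0 *)

Section DiracKernel.
Variable R : realType.
Local Notation C := (R[i]).
Local Notation P := {mpoly C[3]}.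
Implicit Types (p q : P) (v : V R) (m : 'X_{1..3}) (k : 'I_3 -> R).

Lemma eq_lincomb2 (F : pzRingType) (k l u v u' v' x y : F) :
  u = v -> u' = v' -> x - y = k * (u - v) + l * (u' - v') -> x = y.
Proof. by move=> -> ->; rewrite !subrr !mulr0 addr0 => /subr0_eq. Qed.

Lemma sqr_imag : 'i%C ^+ 2 = -1 :> C.
Proof. exact: sqr_i. Qed.

Lemma DopE k v : Dop k v =
  (dunkl k I1 v.2 - 'i%C *: dunkl k I2 v.2 + dunkl k I3 v.1,
   dunkl k I1 v.1 + 'i%C *: dunkl k I2 v.1 - dunkl k I3 v.2).
Proof.
rewrite /Dop !etensE. by rewrite /= scaleNr.
Qed.

Lemma Dop_coef1 k v m : (Dop k v).1@_m =
  lam (k I1) (m I1).+1 * v.2@_(m + U_(I1))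
  - 'i%C * (lam (k I2) (m I2).+1 * v.2@_(m + U_(I2)))
  + lam (k I3) (m I3).+1 * v.1@_(m + U_(I3)).
Proof.
rewrite DopE; move: (mcoeff_dunkl k); move: (dunkl k) => T hT /=.
by rewrite mcoeffD mcoeffB mcoeffZ !hT.
Qed.

Lemma Dop_coef2 k v m : (Dop k v).2@_m =
  lam (k I1) (m I1).+1 * v.1@_(m + U_(I1))
  + 'i%C * (lam (k I2) (m I2).+1 * v.1@_(m + U_(I2)))
  - lam (k I3) (m I3).+1 * v.2@_(m + U_(I3)).
Proof.
rewrite DopE; move: (mcoeff_dunkl k); move: (dunkl k) => T hT /=.
by rewrite mcoeffB mcoeffD mcoeffZ !hT.
Qed.

(** The equation D v = 0 multiplied by e_2, which isolates T_2. The products e_2 e_1 and e_2 e_3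
    anticommute with e_2, so the right-hand side lives in the other eigenspace [~~ s]. *)
Definition Deq k (u : bool -> nat -> nat -> nat -> C) := forall s a b c,
  lam (k I2) b.+1 * u s a b.+1 c = 'i%C * lam (k I1) a.+1 * u (~~ s) a.+1 b c
     - (-1) ^+ s * lam (k I3) c.+1 * u (~~ s) a b c.+1.

Lemma Dop_eq0 k v : Dop k v = 0 <-> Deq k (ucf v).
Proof.
split=> [D0 s a b c|D0].
  have e1 := Dop_coef1 k v (mn a b c); have e2 := Dop_coef2 k v (mn a b c).
  rewrite D0 mnU1 mnU2 mnU3 !mnE /= mcoeff0 in e1 e2.
  have i2 := sqr_imag; rewrite /ucf.
  (* The combination used is [- (-1) ^+ s] times the e_2-coordinate [s] of D v. *)
  apply: (eq_lincomb (k := 1)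
    (u := - ((-1) ^+ s * 0 - 'i%C * 0))
    (v := - ((-1) ^+ s * (lam (k I1) a.+1 * v.2@_(mn a.+1 b c) -
       'i%C * (lam (k I2) b.+1 * v.2@_(mn a b.+1 c)) + lam (k I3) c.+1 * v.1@_(mn a b c.+1))
     - 'i%C * (lam (k I1) a.+1 * v.1@_(mn a.+1 b c) +
       'i%C * (lam (k I2) b.+1 * v.1@_(mn a b.+1 c)) - lam (k I3) c.+1 * v.2@_(mn a b c.+1))))).
    by rewrite {1}e1 {1}e2.
  move: (lam _ _) (lam _ _) (lam _ _) (v.1@_ _) (v.2@_ _) (v.1@_ _) (v.2@_ _)
    (v.1@_ _) (v.2@_ _) => *.
  by case: s; rewrite /= ?expr0 ?expr1; ring: i2.
have i2 := sqr_imag.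
suff h m : (Dop k v).1@_m = 0 /\ (Dop k v).2@_m = 0.
  by apply: injective_projections; apply/mpolyP => m; rewrite mcoeff0; case: (h m).
rewrite (mn_id m); move: (m I1) (m I2) (m I3) => a b c.
rewrite Dop_coef1 Dop_coef2 mnU1 mnU2 mnU3 !mnE.
have := D0 true a b c; have := D0 false a b c; rewrite /ucf /= expr0 expr1.
move: (lam _ _) (lam _ _) (lam _ _) (v.1@_ _) (v.2@_ _) (v.1@_ _) (v.2@_ _) (v.1@_ _) (v.2@_ _).
move=> x y z p1 p2 q1 q2 r1 r2 e1 e2; split.
  by apply: (eq_lincomb2 (k := 1 / 2) (l := - 1 / 2) e1 e2); field: i2.
by apply: (eq_lincomb2 (k := 'i%C / 2) (l := 'i%C / 2) e1 e2); field: i2.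
Qed.

(* The operators on the restriction to [x_2 = 0] of an element of [ker D]. *)
Lemma mcoeff_op (x y z w : C) (p1 p2 p3 p4 : P) m :
  (x *: p1 + y *: p2 + z *: p3 + w *: p4)@_m
  = x * p1@_m + y * p2@_m + z * p3@_m + w * p4@_m.
Proof. by rewrite !mcoeffD !mcoeffZ. Qed.

(** At x_2 = 0 the angular part retains only x_3 T_2, which reads the coefficients of x_2^1. The
    equation [Deq] trades these for coefficients of x_2^0, and the two changes of eigenspace, by e_1
    and by [Deq], compensate. *)
Lemma Xop_coef k v s a c : Deq k (ucf v) ->
  ucf (Xop k v) s a 0 c =
   ((-1) ^+ c * (lam (k I3) c + 2^-1 + kC (k I2)) + kC (k I3)) * ucf v s a 0 c
   - (if c is c'.+1 then 'i%C * (-1) ^+ s * (-1) ^+ c' * lam (k I1) a.+1 * ucf v s a.+1 0 c'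
      else 0).
Proof.
move=> D; have i2 := sqr_imag; rewrite /Xop /Rop /liftP etensE /= /ucf /=.
rewrite /angular; move: (mcoeff_dunkl k) (@mcoeff_refl R).
move: (dunkl k) (@refl R) => T r hT hr.
have comp p q : ('i%C *: ('X_I3 * T I2 (r I2 (r I3 p)) - 'X_I2 * T I3 (r I2 (r I3 p)))
    + 2^-1 *: r I2 (r I3 q) + kC (k I2) *: r I3 q + kC (k I3) *: r I2 q)@_(mn a 0 c)
  = 'i%C * (if c is c'.+1 then - lam (k I2) 1 * (-1) ^+ c' * p@_(mn a 1 c') else 0)
    + 2^-1 * ((-1) ^+ c * q@_(mn a 0 c)) + kC (k I2) * ((-1) ^+ c * q@_(mn a 0 c))
    + kC (k I3) * q@_(mn a 0 c).
  rewrite mcoeff_op; congr (_ * _ + _ * _ + _ * _ + _ * _).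
  - rewrite mcoeffB [X in _ - X]mcoeff_mulX0 ?mnE // subr0.
    case: c => [|c]; first by apply: mcoeff_mulX0; rewrite mnE.
    rewrite -mnU3 mcoeff_mulX hT !hr mnU2 !mnE.
    by move: (p@_ _) (lam _ _) => *; ring.
  - by rewrite !hr !mnE mul1r.
  - by rewrite !hr !mnE.
  - by rewrite !hr !mnE mul1r.
rewrite !comp {comp}.
case: c => [|c].
  rewrite /lam /= expr0; move: (v.1@_ _) (v.2@_ _) => *; ring.
have := D (~~ s) a 0%N c; rewrite /ucf negbK.
move: (v.1@_ _) (v.2@_ _) (v.1@_ _) (v.2@_ _) (v.1@_ _) (v.2@_ _) => p1 p2 p3 p4 p5 p6.
move: (lam _ _) (lam _ _) (lam _ _) => l1 l2 l3 e.
apply: (eq_lincomb (k := - (-1) ^+ s * (-1) ^+ c) e).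
by rewrite exprS; case: s {D e}; rewrite /= ?expr0 ?expr1; field: i2.
Qed.

(** As for X, with x_1 T_2 as the surviving term and e_3 in place of e_1. *)
Lemma Zop_coef k v s a c : Deq k (ucf v) ->
  ucf (Zop k v) s a 0 c =
   ((-1) ^+ a * (lam (k I1) a + 2^-1 + kC (k I2)) + kC (k I1)) * ucf v s a 0 c
   + (if a is a'.+1 then 'i%C * (-1) ^+ s * (-1) ^+ a' * lam (k I3) c.+1 * ucf v s a' 0 c.+1
      else 0).
Proof.
move=> D; have i2 := sqr_imag; rewrite /Zop /Rop /liftP etensE /= /ucf /=.
rewrite /angular; move: (mcoeff_dunkl k) (@mcoeff_refl R).
move: (dunkl k) (@refl R) => T r hT hr.
have comp p : ('X_I2 * T I1 (r I1 (r I2 p)) - 'X_I1 * T I2 (r I1 (r I2 p)))@_(mn a 0 c)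
  = if a is a'.+1 then lam (k I2) 1 * (-1) ^+ a' * p@_(mn a' 1 c) else 0.
  rewrite mcoeffB [X in X - _]mcoeff_mulX0 ?mnE // sub0r.
  case: a => [|a]; first by rewrite mcoeff_mulX0 ?oppr0 // mnE.
  rewrite -mnU1 mcoeff_mulX hT !hr mnU2 !mnE.
  by move: (p@_ _) (lam _ _) => *; ring.
have compr q : ((r I1 (r I2 q))@_(mn a 0 c) = (-1) ^+ a * q@_(mn a 0 c)) *
    ((r I2 q)@_(mn a 0 c) = q@_(mn a 0 c)) *
    ((r I1 q)@_(mn a 0 c) = (-1) ^+ a * q@_(mn a 0 c)).
  by rewrite !hr !mnE expr0 !mul1r.
rewrite !mcoeff_op mcoeffN !comp !compr {comp compr}.
case: a => [|a].
  rewrite /lam /= expr0; move: (v.1@_ _) (v.2@_ _) => *; ring.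
have := D (~~ s) a 0%N c; rewrite /ucf negbK.
move: (v.1@_ _) (v.2@_ _) (v.1@_ _) (v.2@_ _) (v.1@_ _) (v.2@_ _) => p1 p2 p3 p4 p5 p6.
move: (lam _ _) (lam _ _) (lam _ _) => l1 l2 l3 e.
apply: (eq_lincomb (k := 'i%C * (-1) ^+ a) e).
by rewrite exprS; case: s {D e}; rewrite /= ?expr0 ?expr1; field: i2.
Qed.

Lemma Yop_coef k v s a c :
  ucf (Yop k v) s a 0 c = ((-1) ^+ (a + c) / 2 + kC (k I3) * (-1) ^+ a + kC (k I1) * (-1) ^+ c)
     * ucf v s a 0 c
   + 'i%C * (-1) ^+ s * (-1) ^+ (a + c) *
     ((if a is a'.+1 then lam (k I3) c.+1 * ucf v s a' 0 c.+1 else 0)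
      - (if c is c'.+1 then lam (k I1) a.+1 * ucf v s a.+1 0 c' else 0)).
Proof.
have i2 := sqr_imag; rewrite /Yop /Rop /liftP etensE /= /ucf /=.
rewrite /angular; move: (mcoeff_dunkl k) (@mcoeff_refl R).
move: (dunkl k) (@refl R) => T r hT hr.
have comp p : ('X_I1 * T I3 (r I1 (r I3 p)) - 'X_I3 * T I1 (r I1 (r I3 p)))@_(mn a 0 c)
  = (if a is a'.+1 then lam (k I3) c.+1 * ((-1) ^+ (a + c) * p@_(mn a' 0 c.+1)) else 0)
   - (if c is c'.+1 then lam (k I1) a.+1 * ((-1) ^+ (a + c) * p@_(mn a.+1 0 c')) else 0).
  rewrite mcoeffB; congr (_ - _).
    case: a => [|a]; first by apply: mcoeff_mulX0; rewrite mnE.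
    rewrite -mnU1 mcoeff_mulX hT !hr mnU3 !mnE exprD !exprS.
    by move: (p@_ _) (lam _ _) => *; ring.
  case: c => [|c]; first by apply: mcoeff_mulX0; rewrite mnE.
  rewrite -mnU3 mcoeff_mulX hT !hr mnU1 !mnE exprD !exprS.
  by move: (p@_ _) (lam _ _) => *; ring.
have compr q : ((r I1 (r I3 q))@_(mn a 0 c) = (-1) ^+ (a + c) * q@_(mn a 0 c)) *
    ((r I3 q)@_(mn a 0 c) = (-1) ^+ c * q@_(mn a 0 c)) *
    ((r I1 q)@_(mn a 0 c) = (-1) ^+ a * q@_(mn a 0 c)).
  by rewrite !hr !mnE exprD mulrA.
rewrite !mcoeff_op !mcoeffZ !comp !compr {comp compr}.
case: a => [|a]; case: c => [|c];
  move: (v.1@_ _) (v.2@_ _) ((-1) ^+ (_ + _)) => p1 p2 e0.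
- by case: s; rewrite /= ?expr0 ?expr1; field: i2.
- move: (v.1@_ _) (v.2@_ _) (lam _ _) => p3 p4 l1.
  by case: s; rewrite /= ?expr0 ?expr1; field: i2.
- move: (v.1@_ _) (v.2@_ _) (lam _ _) => p3 p4 l1.
  by case: s; rewrite /= ?expr0 ?expr1; field: i2.
move: (v.1@_ _) (v.2@_ _) (v.1@_ _) (v.2@_ _) (lam _ _) (lam _ _)  => p3 p4 p5 p6 l1 l3.
by case: s; rewrite /= ?expr0 ?expr1; field: i2.
Qed.

Lemma homog_coef n v : v.1 \is n.-homog -> v.2 \is n.-homog ->
  forall s a b c, (a + b + c)%N != n -> ucf v s a b c = 0.
Proof.
move=> h1 h2 s a b c ne; rewrite /ucf.
have z p : p \is n.-homog -> p@_(mn a b c) = 0.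
  by move=> hp; apply: (dhomog_nemf_coeff hp); rewrite /= mdeg_mn.
by rewrite !z ?mulr0 ?subr0.
Qed.

Lemma ucf_eq0 v a b c : (forall s, ucf v s a b c = 0) ->
  v.1@_(mn a b c) = 0 /\ v.2@_(mn a b c) = 0.
Proof.
move=> h; have := h true; have := h false.
rewrite /ucf expr0 expr1 => e1 e2; have i2 := sqr_imag; split.
  by apply: (eq_lincomb2 (k := 1 / 2) (l := 1 / 2) e1 e2); field: i2.
by apply: (eq_lincomb2 (k := 'i%C / 2) (l := - 'i%C / 2) e1 e2); field: i2.
Qed.

(* Cauchy-Kovalevskaya: an element of [ker D] is determined by its
   restriction to [x_2 = 0]; [Q] is an invariant set of exponents of x_1, x_3. *)
Lemma ck_unique n k v (Q : nat -> nat -> bool) :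
  Mn k n v -> (forall b, (0 < b <= n)%N -> lam (k I2) b != 0) ->
  (forall a c, Q a c -> Q a.+1 c \/ lam (k I1) a.+1 = 0) ->
  (forall a c, Q a c -> Q a c.+1 \/ lam (k I3) c.+1 = 0) ->
  (forall s a c, Q a c -> ucf v s a 0 c = 0) ->
  forall s a b c, Q a c -> ucf v s a b c = 0.
Proof.
move=> [h1 [h2 /Dop_eq0 D]] l2 Q1 Q3 v0 s a b; elim: b s a => [|b IHb] s a c Qac.
  exact: v0.
have [e|ne] := eqVneq (a + b.+1 + c)%N n; last exact: (homog_coef h1 h2).
have bn : (0 < b.+1 <= n)%N by lia.
apply: (mulfI (l2 _ bn)); rewrite mulr0 D.
have e1 : lam (k I1) a.+1 * ucf v (~~ s) a.+1 b c = 0.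
  by have [/IHb ->|->] := Q1 _ _ Qac; rewrite ?mulr0 ?mul0r.
have e3 : lam (k I3) c.+1 * ucf v (~~ s) a b c.+1 = 0.
  by have [/IHb ->|->] := Q3 _ _ Qac; rewrite ?mulr0 ?mul0r.
by rewrite -!mulrA e1 e3 !mulr0 subr0.
Qed.

(** The recursion on the exponent of x_2 for given data [h] at x_2 = 0. Past b = n the divisor may
    vanish, but for data of degree [n] the numerator is then 0 by homogeneity. *)
Fixpoint ck k (h : bool -> nat -> nat -> C) b s a c : C :=
  if b is b'.+1 then
    ('i%C * lam (k I1) a.+1 * ck k h b' (~~ s) a.+1 c
     - (-1) ^+ s * lam (k I3) c.+1 * ck k h b' (~~ s) a c.+1) / lam (k I2) b
  else h s a c.

Lemma ck_homog n k h : (forall s a c, (a + c)%N != n -> h s a c = 0) ->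
  forall b s a c, (a + b + c)%N != n -> ck k h b s a c = 0.
Proof.
move=> h0; elim=> [|b IHb] s a c ne /=; first by apply: h0; rewrite -[a]addn0.
by rewrite !IHb ?mulr0 ?subrr ?mul0r //; move: ne; lia.
Qed.

Lemma ck_exists n k h : (forall s a c, (a + c)%N != n -> h s a c = 0) ->
  (forall b, (0 < b <= n)%N -> lam (k I2) b != 0) ->
  exists v, Mn k n v /\ forall s a c, ucf v s a 0 c = h s a c.
Proof.
move=> h0 l2; pose F s m := ck k h (m I2) s (m I1) (m I3).
have F0 s m : (mdeg m != n)%N -> F s m = 0.
  by move=> mn; apply: (ck_homog k h0); rewrite -mdeg_mn -mn_id.
(* Inverse of the passage to e_2-coordinates. *)
pose G1 m := (F false m + F true m) / 2.
pose G2 m := 'i%C * (F false m - F true m) / 2.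
pose toP (G : 'X_{1..3} -> C) : P := \sum_(m : 'X_{1..3 < n.+1}) G m *: 'X_[m].
have toPE (G : 'X_{1..3} -> C) m : (forall m, mdeg m != n -> G m = 0) -> (toP G)@_m = G m.
  move=> Gn; have [lt|le] := ltnP (mdeg m) n.+1; first exact: mcoeff_mpoly.
  rewrite Gn ?gtn_eqF // raddf_sum big1 // => -[m' lt'] _ /=.
  rewrite mcoeffZ mcoeffX; case: eqP => [e|]; last by rewrite mulr0.
  by move: lt'; rewrite e ltnNge le.
have toP_homog G : (forall m, mdeg m != n -> G m = 0) -> toP G \is n.-homog.
  move=> Gn; apply/dhomogP => m; rewrite mcoeff_msupp toPE // => Gm.
  by apply/eqP; apply: contraNT Gm => /Gn ->.
have G10 m : mdeg m != n -> G1 m = 0 by move=> /F0 e; rewrite /G1 !e addr0 mul0r.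
have G20 m : mdeg m != n -> G2 m = 0 by move=> /F0 e; rewrite /G2 !e subrr mulr0 mul0r.
have i2 := sqr_imag.
have uE s a b c : ucf (toP G1, toP G2) s a b c = ck k h b s a c.
  rewrite /ucf /= !toPE // /G1 /G2 /F !mnE; case: s; rewrite /= ?expr0 ?expr1.
    by move: (ck k h b false a c) (ck k h b true a c) => x y; field: i2.
  by move: (ck k h b false a c) (ck k h b true a c) => x y; field: i2.
exists (toP G1, toP G2); split; last by move=> s a c; rewrite uE.
split; first exact: toP_homog; split; first exact: toP_homog.
apply/Dop_eq0 => s a b c; rewrite !uE /=.
(* In total degree [n] the divisor is nonzero since b + 1 is at most n; in other degrees both sides
   vanish. *)
have [e|ne] := eqVneq (a + b.+1 + c)%N n.
  have bn : (0 < b.+1 <= n)%N by lia.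
  by rewrite mulrC divfK // l2.
have z1 : ck k h b (~~ s) a.+1 c = 0 by apply: (ck_homog k h0); lia.
have z3 : ck k h b (~~ s) a c.+1 = 0 by apply: (ck_homog k h0); lia.
by rewrite z1 z3 !mulr0 subrr mul0r mulr0.
Qed.

End DiracKernel.

(** * The three blocks of M_n *)

Section Rescaling.
Variable R : realType.
Local Notation C := (R[i]).
Implicit Types (v : V R) (k : 'I_3 -> R).

(** [g s i] is the coordinate of v at the i-th monomial of a block, in the e_2-eigenspace [s]; [p]
    and [q] are the sub- and superdiagonal entries found there. Rescaling the basis turns [p] into 1
    and [q] into [p * q = ph], which does not depend on [s], so the two eigenspaces give two copies
    of one module. The condition at [d.+1] closes the block, either because the entry vanishes or
    because the coordinate does. *)
Lemma rescaled_quot d (S S' : V R -> Prop) k (g : bool -> nat -> V R -> C)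
    (p q : bool -> nat -> C) (a b kap x y z : C) (ph : nat -> C)
    (G : 'I_3 -> 'M[C]_d.+1) (lL lU lT : 'I_3) :
  (forall l, [\/ l = lL, l = lU | l = lT]) ->
  G lL = x *: LBmx a d -> G lU = y *: UBmx b d ph ->
  G lT = z *: third a b d ph kap ->
  ph d.+1 = 0 ->
  (forall s i, (0 < i <= d)%N -> p s i != 0) ->
  (forall s i, (0 < i <= d)%N -> p s i * q s i = ph i) ->
  (forall s i t u v, g s i (t *: u + v) = t * g s i u + g s i v) ->
  (forall s v, S v -> q s d.+1 * g s d.+1 v = 0) ->
  (forall s i v, S v -> (i <= d)%N -> g s i (BIop k lL v) =
     x * (theta a d i * g s i v + p s i * shift (fun j => g s j v) i)) ->
  (forall s i v, S v -> (i <= d)%N -> g s i (BIop k lU v) =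
     y * (theta b d i * g s i v + q s i.+1 * g s i.+1 v)) ->
  (forall s i v, S v -> (i <= d)%N -> g s i (BIop k lT v) =
     z * ((2 * theta a d i * theta b d i + (if i is 0%N then 0 else ph i) + ph i.+1 - kap) * g s i v
          + (-1) ^+ i * p s i * shift (fun j => g s j v) i
          - (-1) ^+ i * q s i.+1 * g s i.+1 v)) ->
  (forall v, S v -> (S' v <-> forall s i, (i <= d)%N -> g s i v = 0)) ->
  (forall w : bool -> nat -> C,
     exists v, S v /\ forall s i, (i <= d)%N -> g s i v = w s i) ->
  iso_quot S S' (BIop k) (dsum2 G).
Proof.
move=> l3 GL GU GT phd p0 pq glin gend hL hU hT hker hsurj.
pose nu s i := \prod_(j < i) (p s j.+1)^-1.
have nu0 s i : (i <= d)%N -> nu s i != 0.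
  move=> id; apply/prodf_neq0 => j _; rewrite invr_neq0 // p0 //=.
  exact: leq_trans (ltn_ord j) id.
have nuS s i : (i < d)%N -> nu s i = nu s i.+1 * p s i.+1.
  by move=> id; rewrite /nu big_ord_recr /= mulfVK // p0.
pose fs s v : 'cV[C]_d.+1 := \col_i (nu s i * g s i v).
have fsE s v i : (i <= d)%N -> entry (fs s v) i = nu s i * g s i v.
  by move=> id; rewrite /entry id mxE inordK.
have shE s v i : (i <= d)%N -> shift (entry (fs s v)) i =
    nu s i * p s i * shift (fun j => g s j v) i.
  by case: i => [|i] id /=; rewrite ?mulr0 // fsE 1?ltnW // (nuS s i id).
have upE s v i : S v -> (i <= d)%N -> ph i.+1 * entry (fs s v) i.+1 =
    nu s i * q s i.+1 * g s i.+1 v.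
  move=> Sv; rewrite leq_eqVlt => /orP[/eqP->|id].
    by rewrite phd mul0r -mulrA gend // mulr0.
  by rewrite fsE // (nuS s i id) -(pq s i.+1 id); ring.
(* Since consecutive eigenvalues add up to a sign, the off-diagonal entries of the third generator
   are, up to sign, those of A and B. *)
have thS (e : C) i : theta e d i + theta e d i.+1 = - (-1) ^+ i.
  by rewrite /theta exprS; field.
have fL s v : S v -> fs s (BIop k lL v) = G lL *m fs s v.
  move=> Sv; rewrite GL -scalemxAl; apply: entryP => i id.
  by rewrite entryZ entry_LB // /lseq shE // !fsE // hL //; ring.
have fU s v : S v -> fs s (BIop k lU v) = G lU *m fs s v.
  move=> Sv; rewrite GU -scalemxAl; apply: entryP => i id.
  by rewrite entryZ entry_UB // /useq upE // !fsE // hU //; ring.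
have fT s v : S v -> fs s (BIop k lT v) = G lT *m fs s v.
  move=> Sv; rewrite GT -scalemxAl; apply: entryP => i id.
  rewrite entryZ entry_third // fsE // hT // /tseq.
  have e1 : theta a d i = - (-1) ^+ i - theta a d i.+1 by rewrite -(thS a); ring.
  have u1 : ph i.+1 * lseq (theta a d) (entry (fs s v)) i.+1 =
      (theta a d i.+1 * (nu s i * q s i.+1 * g s i.+1 v))
      + ph i.+1 * (nu s i * g s i v).
    by rewrite /lseq mulrDr mulrCA upE // -fsE.
  rewrite [useq _ _ (lseq _ _) i]/useq u1 [lseq _ (useq _ _ _) i]/lseq.
  rewrite [useq _ _ _ i]/useq upE // [lseq _ _ i]/lseq shE // fsE //.
  case: i id e1 {u1} => [|i] id e1 /=; first by rewrite !e1 expr0; ring.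
  have i'd : (i <= d)%N by apply: ltnW.
  rewrite /useq !fsE // (nuS s i id) exprS.
  have e2 : theta b d i = - (-1) ^+ i - theta b d i.+1 by rewrite -(thS b); ring.
  by rewrite !e1 !e2 !exprS; ring.
have fG s l v : S v -> fs s (BIop k l v) = G l *m fs s v.
  by case: (l3 l) => ->; [apply: fL | apply: fU | apply: fT].
have flin s t u v : fs s (t *: u + v) = t *: fs s u + fs s v.
  by apply/colP => i; rewrite !mxE glin; ring.
have fs0 s v : fs s v = 0 -> forall i, (i <= d)%N -> g s i v = 0.
  move=> e i id; apply/(mulfI (nu0 s i id)); rewrite mulr0 -fsE // e.
  by rewrite /entry; case: ifP; rewrite ?mxE.
exists (fun v => col_mx (fs false v) (fs true v)); split.
- split=> [t u v _ _|l v Sv]; first by rewrite !flin -add_col_mx -scale_col_mx.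
  by rewrite /dsum2 mul_block_col !mul0mx addr0 add0r -!fG.
- move=> v Sv; rewrite hker //; split=> [|h].
    move=> /eqP; rewrite col_mx_eq0 => /andP[/eqP e1 /eqP e2] [] i id; exact: fs0.
  have fz s : fs s v = 0.
    by apply/colP => i; rewrite !mxE h ?mulr0 // -ltnS.
  by rewrite !fz col_mx0.
move=> w; pose ws (s : bool) := if s then dsubmx w else usubmx w.
have [v [Sv hv]] := hsurj (fun s i => (nu s i)^-1 * entry (ws s) i).
have fw s : fs s v = ws s.
  by apply: entryP => i id; rewrite fsE // hv // mulVKf // nu0.
by exists v; rewrite !fw vsubmxK.
Qed.

Lemma iso_sub_quot m (S : V R -> Prop) k (G : 'I_3 -> 'M[C]_m) :
  (forall t u v, S u -> S v -> S (t *: u + v)) ->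
  iso_quot S (fun v => v = 0) (BIop k) G -> iso_sub S (BIop k) G.
Proof.
move=> Slin [f [[flin fG] fker fsurj]]; exists f; split => // u v Su Sv e.
apply/eqP; rewrite -subr_eq0; apply/eqP; rewrite addrC -scaleN1r.
by apply/fker; [apply: Slin | rewrite flin // e scaleN1r addNr].
Qed.

End Rescaling.

(** * Identification of the blocks with the given modules *)

Section Main.
Variables (R : realType) (k1 k2 k3 : R) (n t1 t3 : nat).
Hypotheses (hn : odd n) (ot1 : odd t1) (ek1 : 2 * k1 = - t1%:R)
  (ot3 : odd t3) (ek3 : 2 * k3 = - t3%:R)
  (ht2 : forall t : nat, odd t -> 2 * k2 = - t%:R -> (n < t)%N)
  (hle : (t1 + t3 <= n)%N).
Local Notation C := (R[i]).
Local Notation k := (kvec k1 k2 k3).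
Local Notation M := (Mn k n).
Local Notation M1 := (Mnx k n I1).
Local Notation M3 := (Mnx k n I3).
Local Notation M13 := (setI2 M1 M3).
Implicit Types (v : V R).

Lemma kCE (x : R) t : 2 * x = - t%:R -> kC x = - t%:R / 2.
Proof.
move=> e; have -> : x = - t%:R / 2 by apply: (eq_lincomb (k := 1 / 2) e); field.
by rewrite /kC -complexr0; rewrite -[LHS]/(real_complex R _) rmorphM rmorphN fmorphV !rmorph_nat.
Qed.

Lemma lamE (x : R) t j : 2 * x = - t%:R -> lam x j = j%:R - (odd j)%:R * t%:R.
Proof. by move=> /kCE e; rewrite /lam e; case: odd; field. Qed.

Lemma lam0 (x : R) t : odd t -> 2 * x = - t%:R -> lam x t = 0.
Proof. by move=> ot e; rewrite (lamE _ e) ot mul1r subrr. Qed.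

Lemma lam_neq0 (x : R) t j : odd t -> 2 * x = - t%:R -> (0 < j)%N -> j != t ->
  lam x j != 0.
Proof.
move=> ot e j0 jt; rewrite (lamE _ e); case: odd.
  by rewrite mul1r subr_eq0 eqr_nat.
by rewrite mul0r subr0 pnatr_eq0 -lt0n.
Qed.

Lemma lam2_neq0 b : (0 < b <= n)%N -> lam (k I2) b != 0.
Proof.
move=> /andP[b0 bn]; rewrite -[k I2]/k2 /lam; have [ob|eb] := boolP (odd b); last first.
  by rewrite mul0r addr0 pnatr_eq0 -lt0n.
have -> : b%:R + 1 * (2 * kC k2) = kC (b%:R + 2 * k2) :> C.
  by rewrite /kC -!complexr0 -[RHS]/(real_complex R _) rmorphD rmorphM !rmorph_nat mul1r.
apply/eqP => e; have := @ht2 b ob; rewrite ltnNge bn => h; apply/notF/h.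
by case: e => e; apply: (eq_lincomb (k := 1) e); ring.
Qed.

Lemma geTP (x : R) t j : odd t -> 2 * x = - t%:R -> geT x j <-> (t <= j)%N.
Proof.
move=> ot e; split=> [[t' [_ e' h]]|h]; last by exists t.
move: e'; rewrite e => /oppr_inj /eqP; rewrite eqr_nat => /eqP ->; exact: h.
Qed.

Lemma Mn_Deq v : M v -> Deq k (ucf v).
Proof. by case=> _ [_ /Dop_eq0]. Qed.

Lemma Mn_homog v s a c : M v -> (a + c)%N != n -> ucf v s a 0 c = 0.
Proof. by move=> [h1 [h2 _]] ne; apply: (homog_coef h1 h2); rewrite addn0. Qed.

Lemma M1P v : M v -> (M1 v <-> forall s a c, (a < t1)%N -> ucf v s a 0 c = 0).
Proof.
move=> Mv; split=> [[_ [h1 h2]] s a c at1|h].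
  have z (p : {mpoly C[3]}) : (forall m, m \in msupp p -> geT (k I1) (m I1)) ->
      p@_(mn a 0 c) = 0.
    move=> hp; apply/eqP; rewrite mcoeff_eq0; apply/negP => /hp.
    by rewrite (geTP _ ot1 ek1) mnE leqNgt at1.
  by rewrite /ucf !z // mulr0 subr0.
(* The range a < t1 is stable because T_1 kills x_1^t1: passing from a = t1 - 1 to t1 carries the
   factor [lam k1 t1 = 0]. *)
have z := ck_unique (Q := fun a _ => (a < t1)%N) Mv lam2_neq0 _ _ h.
have {}z s a b c : (a < t1)%N -> ucf v s a b c = 0.
  apply: z => [a' c' |a' c' h']; last by left.
  rewrite leq_eqVlt => /orP[/eqP e|h']; last by left.
  by right; rewrite e (lam0 ot1 ek1).
split=> //; split=> m; rewrite (mn_id m) mcoeff_msupp mnE => hm;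
  apply/(geTP _ ot1 ek1); rewrite leqNgt; apply: contra hm => /(fun h' s => z s _ (m I2) (m I3) h')
   /ucf_eq0[e1 e2]; by rewrite ?e1 ?e2.
Qed.

Lemma M3P v : M v -> (M3 v <-> forall s a c, (c < t3)%N -> ucf v s a 0 c = 0).
Proof.
move=> Mv; split=> [[_ [h1 h2]] s a c at1|h].
  have z (p : {mpoly C[3]}) : (forall m, m \in msupp p -> geT (k I3) (m I3)) ->
      p@_(mn a 0 c) = 0.
    move=> hp; apply/eqP; rewrite mcoeff_eq0; apply/negP => /hp.
    by rewrite (geTP _ ot3 ek3) mnE leqNgt at1.
  by rewrite /ucf !z // mulr0 subr0.
have z := ck_unique (Q := fun _ c => (c < t3)%N) Mv lam2_neq0 _ _ h.
have {}z s a b c : (c < t3)%N -> ucf v s a b c = 0.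
  apply: z => [a' c' h'|a' c']; first by left.
  rewrite leq_eqVlt => /orP[/eqP e|h']; last by left.
  by right; rewrite e (lam0 ot3 ek3).
split=> //; split=> m; rewrite (mn_id m) mcoeff_msupp mnE => hm;
  apply/(geTP _ ot3 ek3); rewrite leqNgt; apply: contra hm => /(fun h' s => z s (m I1) (m I2) _ h')
   /ucf_eq0[e1 e2]; by rewrite ?e1 ?e2.
Qed.

Lemma Mn_eq0 v : M v -> (forall s a c, ucf v s a 0 c = 0) -> v = 0.
Proof.
move=> Mv h; have z s a b c : ucf v s a b c = 0.
  apply: (ck_unique (Q := fun _ _ => true) Mv lam2_neq0) => // *; by left.
apply: injective_projections; apply/mpolyP => m; rewrite (mn_id m) mcoeff0;
by case: (ucf_eq0 (fun s => z s (m I1) (m I2) (m I3))).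
Qed.

Lemma ucf_lin s a b c (t : C) u v :
  ucf (t *: u + v) s a b c = t * ucf u s a b c + ucf v s a b c.
Proof. rewrite /ucf /= !mcoeffD !mcoeffZ; ring. Qed.

Local Notation K := (kC (k1 + k2 + k3)).
Local Notation N := ((n%:R + 1) / 2 : C).

Lemma kCD (x y : R) : kC (x + y) = kC x + kC y.
Proof. by rewrite /kC -!complexr0 -!/(real_complex R _) rmorphD. Qed.

Lemma sign_compl a c : (a + c)%N = n -> (-1) ^+ a = - (-1) ^+ c :> C.
Proof.
move=> e; rewrite -signr_odd -[in RHS]signr_odd.
have : odd (a + c) by rewrite e.
by rewrite oddD; do 2!case: odd; rewrite //= ?expr0 ?expr1 ?opprK.
Qed.

(** Covers both quotients of (ii). The second hypothesis says that S contains every solution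
    supported on c < t3, which lets coordinates be prescribed freely on that block. *)
Lemma W2_quot (S S' : V R -> Prop) :
  (forall v, S v -> M v) ->
  (forall v, M v -> (forall s a c, (t3 <= c)%N -> ucf v s a 0 c = 0) -> S v) ->
  (forall v, S v -> (S' v <-> M3 v)) ->
  iso_quot S S' (BIop k)
    (dsum2 (twist sgn_id perm23 (Omod t3.-1 (kC k2) (- K - n%:R - 1) (kC k1)))).
Proof.
move=> SM MS S'3.
have t30 : (0 < t3)%N by case: (t3) ot3.
have K1 := kCE ek1; have K3 := kCE ek3.
have T3 : t3.-1%:R = t3%:R - 1 :> C by rewrite -[in RHS](prednK t30) mulrS; ring.
have i2 := sqr_imag R.
(* With i the exponent of x_3, X lowers and Z raises: [p] and [q] are read off [Xop_coef] and
   [Zop_coef] at a = n - i. *)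
pose p s i : C := - 'i%C * (-1) ^+ (s : bool) * (-1) ^+ i.-1 * lam k1 (n - i).+1.
pose q s i : C := 'i%C * (-1) ^+ (s : bool) * (-1) ^+ (n - i) * lam k3 i.
have nE i : (i < t3)%N -> (n - i = (n - i.+1).+1)%N by move: hle ot1; lia.
have cN i : (i < t3)%N -> (-1) ^+ (n - i) = - (-1) ^+ i :> C.
  by move=> h; apply: sign_compl; lia.
have cN' i : (i < t3)%N -> (-1) ^+ (n - i.+1) = (-1) ^+ i :> C.
  by move=> h; rewrite (@sign_compl _ i.+1) ?exprS ?mulN1r ?opprK //; lia.
have bN i : (i < t3)%N -> (n - i)%:R = n%:R - i%:R :> C.
  by move=> h; rewrite natrB //; lia.
apply: (rescaled_quot (g := fun s i v => ucf v s (n - i) 0 i) (p := p) (q := q)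
  (x := 1) (y := 1) (z := 1) (lL := I1) (lU := I3) (lT := I2)
  (a := kC k2) (b := - K - n%:R - 1) (kap := kapO t3.-1 (kC k2) (- K - n%:R - 1) (kC k1))
  (ph := phiO t3.-1 (kC k2) (- K - n%:R - 1) (kC k1))).
- by apply: forall_I3; [constructor 1 | constructor 3 | constructor 2].
- by rewrite /twist OmodE /sgn_id.
- by rewrite /twist OmodE /sgn_id.
- by rewrite /twist OmodE /sgn_id.
- by apply: phiO_last; move: ot3 t30; case: (t3).
- move=> s i id; rewrite /p !mulf_neq0 ?oppr_eq0 ?signr_eq0 //; last first.
    by apply: (lam_neq0 ot1 ek1) => //; lia.
  by apply/eqP => e; move: i2; rewrite e expr0n => /esym/eqP; rewrite oppr_eq0 oner_eq0.
- move=> s [//|i] id; have it : (i < t3)%N by lia.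
  rewrite /p /q /= -nE // (lamE _ ek1) (lamE _ ek3) /phiO.
  rewrite cN' // bN //.
  have -> : odd (n - i) = ~~ odd i by rewrite oddB ?hn //; lia.
  rewrite !kCD K1 K3 T3.
  (* The sign of the e_2-eigenvalue drops out of [p * q] here. *)
  have s2 : (-1) ^+ s * (-1) ^+ s = 1 :> C by rewrite -exprMn mulrNN mulr1 expr1n.
  have s2' : (-1) ^+ i * (-1) ^+ i = 1 :> C by rewrite -exprMn mulrNN mulr1 expr1n.
  by rewrite [i.+1%:R]mulrS /=; case: (odd i) => /=; field: i2 s2 s2'.
- by move=> s i t u v; rewrite ucf_lin.
- by move=> s v _; rewrite prednK // /q (lam0 ot3 ek3) mulr0 mul0r.
- move=> s i v Sv id; rewrite -[BIop k I1]/(Xop k) Xop_coef; last exact: Mn_Deq (SM _ Sv).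
  rewrite -[k I1]/k1 -[k I2]/k2 -[k I3]/k3 (lamE _ ek3) /theta /= T3 K3.
  case: i id => [|i] id /=.
    by move: (ucf _ _ _ _ _) => g; rewrite expr0 /=; field.
  rewrite /p -nE /=; last by lia.
  move: (ucf _ _ _ _ _) (ucf _ _ _ _ _) (lam _ _) => g g' l.
  by rewrite exprS -[(-1) ^+ i]signr_odd; case: (odd i); rewrite /= ?expr0 ?expr1; field.
- move=> s i v Sv id; rewrite -[BIop k I3]/(Zop k) Zop_coef; last exact: Mn_Deq (SM _ Sv).
  have it : (i < t3)%N by lia.
  rewrite -[k I1]/k1 -[k I2]/k2 -[k I3]/k3 (lamE _ ek1) /theta /= T3 !kCD K1 K3.
  rewrite cN // bN // /q.
  have -> : odd (n - i) = ~~ odd i by rewrite oddB ?hn //; lia.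
  rewrite nE //.
  move: (ucf _ _ _ _ _) (ucf _ _ _ _ _) (lam _ _) => g g' l.
  by rewrite -[(-1) ^+ i]signr_odd; case: (odd i); rewrite /= ?expr0 ?expr1; field.
- move=> s i v Sv id; rewrite -[BIop k I2]/(Yop k) Yop_coef.
  have it : (i < t3)%N by lia.
  rewrite -[k I1]/k1 -[k I3]/k3 subnK; last by lia.
  have -> : (-1) ^+ n = -1 :> C by rewrite -signr_odd hn expr1.
  rewrite cN // /kapO /phiO /theta T3 !kCD K1 K3 /q cN' // /p.
  case: i id it => [|i] id it.
    rewrite nE //= expr0; move: (ucf _ _ _ _ _) (ucf _ _ _ _ _) (lam _ _) => g g' l.
    by field.
  have it' : (i < t3)%N by lia.
  rewrite [shift _ _]/= (nE _ it') (nE _ it) /= !exprS.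
  move: (ucf _ _ _ _ _) (ucf _ _ _ _ _) (ucf _ _ _ _ _) (lam _ _) (lam _ _) => g g' g'' l l'.
  by rewrite -[(-1) ^+ i]signr_odd; case: (odd i); rewrite /= ?expr0 ?expr1; field.
- move=> v Sv; rewrite S'3 // M3P; last exact: SM.
  split=> [h s i id|h s a c ct]; first by apply: h; lia.
  have [e|ne] := eqVneq (a + c)%N n; last exact: (Mn_homog _ (SM _ Sv)).
  have -> : a = (n - c)%N by lia.
  by apply: h; lia.
- move=> w.
  have [|v [Mv hv]] := @ck_exists R n k
    (fun s a c => if (a + c == n)%N && (c < t3)%N then w s c else 0) _ lam2_neq0.
    by move=> s a c /negPf ->.
  exists v; split; first by apply: MS => // s a c ct; rewrite hv ltnNge ct andbF.
  by move=> s i id; rewrite hv ifT //; apply/andP; split; lia.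
Qed.

(** The mirror image under x_1 and x_3: the block a < t1 is indexed by the exponent of x_1, so Z
    becomes the lower and X the upper bidiagonal generator. *)
Lemma W3_quot (S S' : V R -> Prop) :
  (forall v, S v -> M v) ->
  (forall v, M v -> (forall s a c, (t1 <= a)%N -> ucf v s a 0 c = 0) -> S v) ->
  (forall v, S v -> (S' v <-> M1 v)) ->
  iso_quot S S' (BIop k)
    (dsum2 (twist sgn_id perm123 (Omod t1.-1 (kC k2) (- K - n%:R - 1) (kC k3)))).
Proof.
move=> SM MS S'1.
have t10 : (0 < t1)%N by case: (t1) ot1.
have K1 := kCE ek1; have K3 := kCE ek3.
have T1 : t1.-1%:R = t1%:R - 1 :> C by rewrite -[in RHS](prednK t10) mulrS; ring.
have i2 := sqr_imag R.
pose p s i : C := 'i%C * (-1) ^+ (s : bool) * (-1) ^+ i.-1 * lam k3 (n - i).+1.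
pose q s i : C := - 'i%C * (-1) ^+ (s : bool) * (-1) ^+ (n - i) * lam k1 i.
have nE i : (i < t1)%N -> (n - i = (n - i.+1).+1)%N by move: hle ot3; lia.
have cN i : (i < t1)%N -> (-1) ^+ (n - i) = - (-1) ^+ i :> C.
  by move=> h; apply: sign_compl; lia.
have cN' i : (i < t1)%N -> (-1) ^+ (n - i.+1) = (-1) ^+ i :> C.
  by move=> h; rewrite (@sign_compl _ i.+1) ?exprS ?mulN1r ?opprK //; lia.
have bN i : (i < t1)%N -> (n - i)%:R = n%:R - i%:R :> C.
  by move=> h; rewrite natrB //; lia.
apply: (rescaled_quot (g := fun s i v => ucf v s i 0 (n - i)) (p := p) (q := q)
  (x := 1) (y := 1) (z := 1) (lL := I3) (lU := I1) (lT := I2)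
  (a := kC k2) (b := - K - n%:R - 1) (kap := kapO t1.-1 (kC k2) (- K - n%:R - 1) (kC k3))
  (ph := phiO t1.-1 (kC k2) (- K - n%:R - 1) (kC k3))).
- by apply: forall_I3; [constructor 2 | constructor 3 | constructor 1].
- by rewrite /twist OmodE /sgn_id.
- by rewrite /twist OmodE /sgn_id.
- by rewrite /twist OmodE /sgn_id.
- by apply: phiO_last; move: ot1 t10; case: (t1).
- move=> s i id; rewrite /p !mulf_neq0 ?oppr_eq0 ?signr_eq0 //; last first.
    by apply: (lam_neq0 ot3 ek3) => //; lia.
  by apply/eqP => e; move: i2; rewrite e expr0n => /esym/eqP; rewrite oppr_eq0 oner_eq0.
- move=> s [//|i] id; have it : (i < t1)%N by lia.
  rewrite /p /q /= -nE // (lamE _ ek1) (lamE _ ek3) /phiO.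
  rewrite cN' // bN //.
  have -> : odd (n - i) = ~~ odd i by rewrite oddB ?hn //; lia.
  rewrite !kCD K1 K3 T1.
  have s2 : (-1) ^+ s * (-1) ^+ s = 1 :> C by rewrite -exprMn mulrNN mulr1 expr1n.
  have s2' : (-1) ^+ i * (-1) ^+ i = 1 :> C by rewrite -exprMn mulrNN mulr1 expr1n.
  by rewrite [i.+1%:R]mulrS /=; case: (odd i) => /=; field: i2 s2 s2'.
- by move=> s i t u v; rewrite ucf_lin.
- by move=> s v _; rewrite prednK // /q (lam0 ot1 ek1) mulr0 mul0r.
- move=> s i v Sv id; rewrite -[BIop k I3]/(Zop k) Zop_coef; last exact: Mn_Deq (SM _ Sv).
  rewrite -[k I1]/k1 -[k I2]/k2 -[k I3]/k3 (lamE _ ek1) /theta /= T1 K1.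
  case: i id => [|i] id /=.
    by move: (ucf _ _ _ _ _) => g; rewrite expr0 /=; field.
  rewrite /p -nE /=; last by lia.
  move: (ucf _ _ _ _ _) (ucf _ _ _ _ _) (lam _ _) => g g' l.
  by rewrite exprS -[(-1) ^+ i]signr_odd; case: (odd i); rewrite /= ?expr0 ?expr1; field.
- move=> s i v Sv id; rewrite -[BIop k I1]/(Xop k) Xop_coef; last exact: Mn_Deq (SM _ Sv).
  have it : (i < t1)%N by lia.
  rewrite -[k I1]/k1 -[k I2]/k2 -[k I3]/k3 (lamE _ ek3) /theta /= T1 !kCD K1 K3.
  rewrite cN // bN // /q.
  have -> : odd (n - i) = ~~ odd i by rewrite oddB ?hn //; lia.
  rewrite nE //.
  move: (ucf _ _ _ _ _) (ucf _ _ _ _ _) (lam _ _) => g g' l.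
  by rewrite -[(-1) ^+ i]signr_odd; case: (odd i); rewrite /= ?expr0 ?expr1; field.
- move=> s i v Sv id; rewrite -[BIop k I2]/(Yop k) Yop_coef.
  have it : (i < t1)%N by lia.
  rewrite -[k I1]/k1 -[k I3]/k3 subnKC; last by lia.
  have -> : (-1) ^+ n = -1 :> C by rewrite -signr_odd hn expr1.
  rewrite cN // /kapO /phiO /theta T1 !kCD K1 K3 /q cN' // /p.
  case: i id it => [|i] id it.
    rewrite nE //= expr0; move: (ucf _ _ _ _ _) (ucf _ _ _ _ _) (lam _ _) => g g' l.
    by field.
  have it' : (i < t1)%N by lia.
  rewrite [shift _ _]/= (nE _ it') (nE _ it) /= !exprS.
  move: (ucf _ _ _ _ _) (ucf _ _ _ _ _) (ucf _ _ _ _ _) (lam _ _) (lam _ _) => g g' g'' l l'.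
  by rewrite -[(-1) ^+ i]signr_odd; case: (odd i); rewrite /= ?expr0 ?expr1; field.
- move=> v Sv; rewrite S'1 // M1P; last exact: SM.
  split=> [h s i id|h s a c at1]; first by apply: h; lia.
  have [e|ne] := eqVneq (a + c)%N n; last exact: (Mn_homog _ (SM _ Sv)).
  have -> : c = (n - a)%N by lia.
  by apply: h; lia.
- move=> w.
  have [|v [Mv hv]] := @ck_exists R n k
    (fun s a c => if (a + c == n)%N && (a < t1)%N then w s a else 0) _ lam2_neq0.
    by move=> s a c /negPf ->.
  exists v; split; first by apply: MS => // s a c at1; rewrite hv ltnNge at1 andbF.
  by move=> s i id; rewrite hv ifT //; apply/andP; split; lia.
Qed.

Lemma W1_sub : iso_sub M13 (BIop k) (dsum2 (twist sgn_m1m1 perm23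
  (Emod (n - t1 - t3) (kC (k1 + k2) + N) (- kC (k2 + k3) - N) N))).
Proof.
have t10 : (0 < t1)%N by case: (t1) ot1.
have t30 : (0 < t3)%N by case: (t3) ot3.
have K1 := kCE ek1; have K3 := kCE ek3.
have i2 := sqr_imag R.
set d := (n - t1 - t3)%N.
have dE : (n = d + t1 + t3)%N by rewrite /d; lia.
have D : d%:R = n%:R - t1%:R - t3%:R :> C by rewrite [in RHS]dE !natrD; ring.
have od : odd d by move: hn; rewrite dE !oddD ot1 ot3; case: odd.
(* The block a >= t1, c >= t3 is indexed by i = c - t3, and [m i] is the exponent of x_1. The signs
   of [p] and [q] are opposite to those in the action of X and Z, because the twist acts by -1 on
   both. *)
pose m i := (n - (t3 + i))%N.
pose p s i : C := 'i%C * (-1) ^+ (s : bool) * (-1) ^+ (t3 + i).-1 * lam k1 (m i).+1.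
pose q s i : C := - 'i%C * (-1) ^+ (s : bool) * (-1) ^+ (m i) * lam k3 (t3 + i).
have mS i : (i <= d)%N -> (m i = (m i.+1).+1)%N by rewrite /m; lia.
have sgt i : (-1) ^+ (t3 + i) = - (-1) ^+ i :> C.
  by rewrite exprD -[(-1) ^+ t3]signr_odd ot3 expr1 mulN1r.
have sgt' i : (-1) ^+ (t3 + i).-1 = (-1) ^+ i :> C.
  by apply: oppr_inj; rewrite -(sgt i) -[in RHS](@prednK (t3 + i)) ?addn_gt0 ?t30 // exprS mulN1r.
have sgm i : (i <= d.+1)%N -> (-1) ^+ m i = (-1) ^+ i :> C.
  by move=> h; rewrite (@sign_compl _ (t3 + i)) ?sgt ?opprK // /m; lia.
have mR i : (i <= d)%N -> (m i)%:R = n%:R - t3%:R - i%:R :> C.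
  by move=> h; rewrite /m natrB ?natrD ?opprD ?addrA //; lia.
have om i : (i <= d)%N -> odd (m i) = odd i.
  by move=> h; rewrite /m oddB ?oddD ?hn ?ot3 //=; [case: odd | lia].
have SM v : M13 v -> M v by case=> [[]].
have z1 v s a c : M13 v -> (a < t1)%N -> ucf v s a 0 c = 0.
  by move=> Sv; have := SM _ Sv => Mv; case: Sv => /(M1P Mv) h _; apply: h.
have z3 v s a c : M13 v -> (c < t3)%N -> ucf v s a 0 c = 0.
  by move=> Sv; have := SM _ Sv => Mv; case: Sv => _ /(M3P Mv) h; apply: h.
have Mlin t u v : M13 u -> M13 v -> M13 (t *: u + v).
  move=> Su Sv; have Muv : M (t *: u + v).
    have [[hu1 [hu2 du]] [hv1 [hv2 dv]]] := (SM _ Su, SM _ Sv).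
    split; first by rewrite /= rpredD // rpredZ.
    split; first by rewrite /= rpredD // rpredZ.
    apply/Dop_eq0 => s a b c; move: du dv => /Dop_eq0 du /Dop_eq0 dv.
    have := dv s a b c; have := du s a b c; rewrite !ucf_lin.
    move: (ucf u _ _ _ _) (ucf u _ _ _ _) (ucf u _ _ _ _) => x1 x2 x3.
    move: (ucf v _ _ _ _) (ucf v _ _ _ _) (ucf v _ _ _ _) => y1 y2 y3.
    move: (lam _ _) (lam _ _) (lam _ _) => l1 l2 l3 e1 e2.
    by apply: (eq_lincomb2 (k := t) (l := 1) e1 e2); ring.
  split; [apply/(M1P Muv) | apply/(M3P Muv)] => s a c h; rewrite ucf_lin.
    by rewrite (z1 _ _ _ _ Su) // (z1 _ _ _ _ Sv) // mulr0 addr0.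
  by rewrite (z3 _ _ _ _ Su) // (z3 _ _ _ _ Sv) // mulr0 addr0.
apply: iso_sub_quot => //.
apply: (rescaled_quot (g := fun s i v => ucf v s (m i) 0 (t3 + i)) (p := p) (q := q)
  (x := -1) (y := -1) (z := 1) (lL := I1) (lU := I3) (lT := I2)
  (a := kC (k1 + k2) + N) (b := - kC (k2 + k3) - N)
  (kap := kapE d (kC (k1 + k2) + N) (- kC (k2 + k3) - N) N)
  (ph := phiE' d (kC (k1 + k2) + N) (- kC (k2 + k3) - N) N)).
- by apply: forall_I3; [constructor 1 | constructor 3 | constructor 2].
- by rewrite /twist EmodE.
- by rewrite /twist EmodE.
- by rewrite /twist EmodE.
- by rewrite /phiE' /= od /= mulrS; ring.
- move=> s i id; rewrite /p !mulf_neq0 ?oppr_eq0 ?signr_eq0 //; last first.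
    by apply: (lam_neq0 ot1 ek1) => //; rewrite /m; lia.
  by apply/eqP => e; move: i2; rewrite e expr0n => /esym/eqP; rewrite oppr_eq0 oner_eq0.
- move=> s i id; have i'd : (i <= d)%N by lia.
  rewrite /p /q sgt' sgm; last by lia.
  rewrite (lamE _ ek1) (lamE _ ek3) mulrS mR // /= om // oddD ot3 natrD /phiE'.
  rewrite !kCD K1 K3 D.
  have s2 : (-1) ^+ s * (-1) ^+ s = 1 :> C by rewrite -exprMn mulrNN mulr1 expr1n.
  have s2' : (-1) ^+ i * (-1) ^+ i = 1 :> C by rewrite -exprMn mulrNN mulr1 expr1n.
  by case: (odd i) => /=; field: i2 s2 s2'.
- by move=> s i t u v; rewrite ucf_lin.
(* Just past the end of the block the exponent of x_1 is [m d.+1 = t1 - 1], where elements of [M1]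
   vanish. *)
- by move=> s v Sv; rewrite z1 ?mulr0 // /m; lia.
- move=> s i v Sv id; rewrite -[BIop k I1]/(Xop k) Xop_coef; last exact: Mn_Deq (SM _ Sv).
  rewrite -[k I1]/k1 -[k I2]/k2 -[k I3]/k3 (lamE _ ek3) /theta /= D !kCD K1 K3.
  rewrite sgt oddD ot3 natrD /p sgt'.
  case: i id => [|i] id /=.
    (* The entry below the start of the block meets the coordinate c = t3 - 1, which is 0 on
       [M3]. *)
    have -> : (if (t3 + 0)%N is c'.+1 then 'i%C * (-1) ^+ s * (-1) ^+ c' * lam k1 (m 0).+1
       * ucf v s (m 0).+1 0 c' else 0) = 0.
      by case E : (t3 + 0)%N => [|c'] //; rewrite z3 ?mulr0 //; lia.
    by move: (ucf _ _ _ _ _) => g; rewrite expr0 /=; field.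
  rewrite addnS -mS; last by lia.
  have := sgt' i.+1; rewrite addnS /= => ->.
  move: (ucf _ _ _ _ _) (ucf _ _ _ _ _) (lam _ _) => g g' l.
  by rewrite exprS -[(-1) ^+ i]signr_odd; case: (odd i); rewrite /= ?expr0 ?expr1; field.
- move=> s i v Sv id; rewrite -[BIop k I3]/(Zop k) Zop_coef; last exact: Mn_Deq (SM _ Sv).
  rewrite -[k I1]/k1 -[k I2]/k2 -[k I3]/k3 (lamE _ ek1) /theta /= D !kCD K1 K3.
  rewrite sgm ?mR // 1?om // 1?leqW // /q (mS _ id) addnS.
  move: (ucf _ _ _ _ _) (ucf _ _ _ _ _) (lam _ _) => g g' l.
  rewrite sgm //.
  by rewrite exprS -[(-1) ^+ i]signr_odd; case: (odd i); rewrite /= ?expr0 ?expr1; field.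
- move=> s i v Sv id; rewrite -[BIop k I2]/(Yop k) Yop_coef.
  have mn : (m i + (t3 + i) = n)%N by rewrite /m; lia.
  rewrite -[k I1]/k1 -[k I3]/k3 mn.
  have -> : (-1) ^+ n = -1 :> C by rewrite -signr_odd hn expr1.
  rewrite sgt sgm 1?leqW // /kapE /phiE' /theta D !kCD K1 K3 /q sgm // /p sgt'.
  case: i id mn => [|i] id mn.
    have -> : (if (t3 + 0)%N is c'.+1 then lam k1 (m 0).+1 * ucf v s (m 0).+1 0 c' else 0) = 0.
      by case E : (t3 + 0)%N => [|c'] //; rewrite z3 ?mulr0 //; lia.
    rewrite (mS _ id) addnS /= expr0.
    move: (ucf _ _ _ _ _) (ucf _ _ _ _ _) (lam _ _) => g g' l.
    by field.
  have id' : (i <= d)%N by lia.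
  rewrite [shift _ _]/= !addnS (mS _ id') (mS _ id) /= !exprS.
  move: (ucf _ _ _ _ _) (ucf _ _ _ _ _) (ucf _ _ _ _ _) (lam _ _) (lam _ _) => g g' g'' l l'.
  by rewrite -[(-1) ^+ i]signr_odd; case: (odd i); rewrite /= ?expr0 ?expr1; field.
- move=> v Sv; split=> [-> s i _|h].
    by rewrite /ucf /= !mcoeff0 mulr0 subr0.
  apply: (Mn_eq0 (SM _ Sv)) => s a c.
  have [at1|at1] := ltnP a t1; first exact: z1.
  have [ct|ct] := ltnP c t3; first exact: z3.
  have [e|ne] := eqVneq (a + c)%N n; last exact: (Mn_homog _ (SM _ Sv)).
  have -> : c = (t3 + (c - t3))%N by lia.
  have -> : a = m (c - t3)%N by rewrite /m; lia.
  by apply: h; lia.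
- move=> w.
  have [|v [Mv hv]] := @ck_exists R n k (fun s a c =>
      if [&& (a + c == n)%N, (t1 <= a)%N & (t3 <= c)%N] then w s (c - t3)%N else 0) _ lam2_neq0.
    by move=> s a c /negPf ->.
  exists v; split.
    split; [apply/(M1P Mv) | apply/(M3P Mv)] => s a c h.
      by rewrite hv [(t1 <= a)%N]leqNgt h /= andbF.
    by rewrite hv [(t3 <= c)%N]leqNgt h /= !andbF.
  move=> s i id; rewrite hv ifT ?addKn //; apply/and3P; rewrite /m; split; lia.
Qed.

End Main.

(** * Non-vanishing of the products when k_2 is nonnegative *)

Section Admissible.
Variables (R : realType) (k2 : R) (k2_ge0 : 0 <= k2) (n t1 t3 : nat).
Hypothesis hle : (t1 + t3 <= n)%N.
Local Notation C := (R[i]).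

(** All the quantities to be bounded away from 0 factor into terms of this shape, which are positive
    reals. *)
Lemma sub_add_k2_neq0 (p q c : nat) : (q < p)%N ->
  p%:R - q%:R + c%:R * kC k2 != 0 :> C.
Proof.
move=> qp; rewrite -natrB ?(ltnW qp) //.
have -> : (p - q)%:R + c%:R * kC k2 = kC ((p - q)%:R + c%:R * k2) :> C.
  by rewrite /kC -!complexr0 -!/(real_complex R _) rmorphD rmorphM !rmorph_nat.
have : 0 < (p - q)%:R + c%:R * k2.
  by rewrite ltr_wpDr ?mulr_ge0 ?ler0n // ltr0n subn_gt0.
by apply: contraTneq => -[->]; rewrite Order.POrderTheory.ltxx.
Qed.

(** Serves W2 as it stands, and W3 with [t1] and [t3] exchanged. *)
Lemma admissibleO b c : odd t3 ->
  b = - (- t1%:R / 2 + kC k2 - t3%:R / 2) - n%:R - 1 -> c = - t1%:R / 2 ->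
  admissible (kC k2) b t3.-1 (phiO t3.-1 (kC k2) b c).
Proof.
move=> ot3 -> -> [//|i] /andP[_ id]; have it : (i.+1 < t3)%N by lia.
have T3 : t3.-1%:R = t3%:R - 1 :> C.
  by rewrite -[in RHS](@prednK t3) ?mulrS; [ring | lia].
have h0 : hcoef (- (- t1%:R / 2 + kC k2 - t3%:R / 2) - n%:R - 1) t3.-1 i.+1 =
    - ((2 * n + 2)%:R - (t1 + 2 * i.+1)%:R + 2%:R * kC k2).
  by rewrite /hcoef T3; field.
split.
(* The factors are padded with [0%:R] terms to fit [sub_add_k2_neq0]; each required inequality
   follows from i + 1 < t3 and t1 + t3 <= n. *)
- have -> : phiO t3.-1 (kC k2) (- (- t1%:R / 2 + kC k2 - t3%:R / 2) - n%:R - 1)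
     (- t1%:R / 2) i.+1
   = if odd i then (i.+1%:R - 0%:R + 0%:R * kC k2) * ((n + 1)%:R - i.+1%:R + 0%:R * kC k2)
     else - (t3%:R - i.+1%:R + 0%:R * kC k2) * ((n + 1)%:R - (t1 + i.+1)%:R + 0%:R * kC k2).
    by rewrite /phiO T3 /=; case: odd => /=; field.
  by case: odd; rewrite mulf_neq0 ?oppr_eq0 // sub_add_k2_neq0 //; lia.
- by rewrite h0 oppr_eq0 sub_add_k2_neq0 //; lia.
have -> : gap (kC k2) (- (- t1%:R / 2 + kC k2 - t3%:R / 2) - n%:R - 1) t3.-1
   (phiO t3.-1 (kC k2) (- (- t1%:R / 2 + kC k2 - t3%:R / 2) - n%:R - 1) (- t1%:R / 2)) i.+1
   = if odd i then ((2 * n + 2)%:R - (t1 + i.+1)%:R + 2%:R * kC k2)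
                   * ((2 * n + 2)%:R - (2 * t1 + 2 * i.+1)%:R + 4%:R * kC k2)
     else ((2 * n + 2)%:R - (t1 + t3 + i.+1)%:R + 2%:R * kC k2)
                   * ((2 * n + 2)%:R - (2 * i.+1)%:R + 4%:R * kC k2).
  by rewrite /gap h0 /phiO T3 /= negbK; case: odd => /=; field.
by case: odd; rewrite mulf_neq0 // sub_add_k2_neq0 //; lia.
Qed.

Lemma admissibleE d a b c : (n = d + t1 + t3)%N ->
  a = - t1%:R / 2 + kC k2 + (n%:R + 1) / 2 ->
  b = - (kC k2 - t3%:R / 2) - (n%:R + 1) / 2 -> c = (n%:R + 1) / 2 ->
  admissible a b d (phiE' d a b c).
Proof.
move=> dE -> -> -> [//|i] /andP[_ id].
have D : d%:R = n%:R - t1%:R - t3%:R :> C by rewrite [in RHS]dE !natrD; ring.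
set b0 := _ - (n%:R + 1) / 2; set a0 := _ + (n%:R + 1) / 2.
have h0 : hcoef b0 d i.+1 =
    - ((2 * n + 2)%:R - (t1 + 2 * t3 + 2 * i.+1)%:R + 2%:R * kC k2).
  by rewrite /hcoef /b0 D; field.
split.
- have -> : phiE' d a0 b0 ((n%:R + 1) / 2) i.+1
   = if odd i then (i.+1%:R - 0%:R + 0%:R * kC k2) * ((d + 1)%:R - i.+1%:R + 0%:R * kC k2)
     else ((t3 + i.+1)%:R - 0%:R + 0%:R * kC k2) * ((n + 1)%:R - (t3 + i.+1)%:R + 0%:R * kC k2).
    by rewrite /phiE' /a0 /b0 natrD D /=; case: odd => /=; field.
  by case: odd; rewrite mulf_neq0 // sub_add_k2_neq0 //; lia.
- by rewrite h0 oppr_eq0 sub_add_k2_neq0 //; lia.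
have -> : gap a0 b0 d (phiE' d a0 b0 ((n%:R + 1) / 2)) i.+1
   = 2 * if odd i then ((n + 1)%:R - (t3 + i.+1)%:R + 2%:R * kC k2)
                   * ((2 * n + 2)%:R - (t1 + 2 * t3 + i.+1)%:R + 2%:R * kC k2)
     else ((n + 1)%:R - (t1 + t3 + i.+1)%:R + 2%:R * kC k2)
                   * ((2 * n + 2)%:R - (t1 + t3 + i.+1)%:R + 2%:R * kC k2).
  by rewrite /gap h0 /phiE' /a0 /b0 D /= negbK; case: odd => /=; field.
by rewrite mulf_neq0 ?pnatr_eq0 //; case: odd; rewrite mulf_neq0 // sub_add_k2_neq0 //; lia.
Qed.

End Admissible.

Theorem theorem8p5 (R : realType) (k1 k2 k3 : R) (n t1 t3 : nat)
  (hn : odd n)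
  (ht1 : odd t1 /\ 2 * k1 = - t1%:R)
  (ht3 : odd t3 /\ 2 * k3 = - t3%:R)
  (ht2 : forall t : nat, odd t -> 2 * k2 = - t%:R -> (n < t)%N)
  (hle : (t1 + t3 <= n)%N) :
  let k := kvec k1 k2 k3 in
  let K : R[i] := kC (k1 + k2 + k3) in
  let N : R[i] := (n%:R + 1) / 2 in
  let M := Mn k n in
  let M1 := Mnx k n I1 in
  let M3 := Mnx k n I3 in
  let M13 := setI2 M1 M3 in
  let W1 := twist sgn_m1m1 perm23
              (Emod (n - t1 - t3) (kC (k1 + k2) + N) (- kC (k2 + k3) - N) N) in
  let W2 := twist sgn_id perm23 (Omod t3.-1 (kC k2) (- K - n%:R - 1) (kC k1)) in
  let W3 := twist sgn_id perm123 (Omod t1.-1 (kC k2) (- K - n%:R - 1) (kC k3)) in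
  [/\ iso_sub M13 (BIop k) (dsum2 W1),
      iso_quot M1 M13 (BIop k) (dsum2 W2) /\ iso_quot M M3 (BIop k) (dsum2 W2),
      iso_quot M3 M13 (BIop k) (dsum2 W3) /\ iso_quot M M1 (BIop k) (dsum2 W3) &
      (0 <= k2 ->
      [/\ mx_irr W1 /\ mx_irr W2 /\ mx_irr W3,
          mx_iso W1 (twist sgn_m11 perm_id
                       (Emod (n - t1 - t3) (kC (k1 + k2) + N) N (kC (k2 + k3) + N))),
          mx_iso W2 (Omod t3.-1 (kC k2) (kC k1) (- K - n%:R - 1)) &
          mx_iso W3 (Omod t1.-1 (- K - n%:R - 1) (kC k3) (kC k2))])].
Proof.
case: ht1 => ot1 ek1; case: ht3 => ot3 ek3.
move=> k K N M M1 M3 M13 W1 W2 W3.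
have K1 := kCE ek1; have K3 := kCE ek3.
have et1 : ~~ odd t1.-1 by case: (t1) ot1.
have et3 : ~~ odd t3.-1 by case: (t3) ot3.
split.
- exact: (W1_sub hn ot1 ek1 ot3 ek3 ht2 hle).
- split; apply: (W2_quot hn ot1 ek1 ot3 ek3 ht2 hle) => //.
  + by move=> v [].
  (* As t1 + t3 <= n, a < t1 and a + c = n force c >= t3. Solutions supported on c < t3 therefore
     lie in [M1]. *)
  + move=> v Mv h; apply/(M1P ot1 ek1 ht2 Mv) => s a c at1.
    have [e|ne] := eqVneq (a + c)%N n; last exact: (Mn_homog _ Mv).
    by apply: h; lia.
  + by move=> v M1v; split=> [[]|].
- split; apply: (W3_quot hn ot1 ek1 ot3 ek3 ht2 hle) => //.
  + by move=> v [].
  + move=> v Mv h; apply/(M3P ot3 ek3 ht2 Mv) => s a c at3.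
    have [e|ne] := eqVneq (a + c)%N n; last exact: (Mn_homog _ Mv).
    by apply: h; lia.
  + by move=> v M3v; split=> [[]|].
move=> k2_ge0.
have od : odd (n - t1 - t3).
  have : odd (n - t1 - t3 + t1 + t3) by rewrite (_ : (_ + _ + _)%N = n) //; lia.
  by rewrite !oddD ot1 ot3; case: odd.
have ad2 : admissible (kC k2) (- K - n%:R - 1) t3.-1 (phiO t3.-1 (kC k2) (- K - n%:R - 1) (kC k1)).
  by apply: (admissibleO k2_ge0 hle) => //; rewrite /K !kCD K1 K3; ring.
have hle' : (t3 + t1 <= n)%N by lia.
have ad3 : admissible (kC k2) (- K - n%:R - 1) t1.-1 (phiO t1.-1 (kC k2) (- K - n%:R - 1) (kC k3)).
  by apply: (admissibleO k2_ge0 hle') => //; rewrite /K !kCD K1 K3; ring.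
have ad1 : admissible (kC (k1 + k2) + N) (- kC (k2 + k3) - N) (n - t1 - t3)
    (phiE' (n - t1 - t3) (kC (k1 + k2) + N) (- kC (k2 + k3) - N) N).
  by apply: (admissibleE k2_ge0 hle) => //; rewrite /N ?kCD ?K1 ?K3; [lia | ring | ring].
split.
- by split; [exact: Emod23_irr | split; [exact: Omod23_irr | exact: Omod123_irr]].
- have -> : kC (k2 + k3) + N = - (- kC (k2 + k3) - N) by rewrite opprD !opprK.
  exact: Emod23_iso.
- exact: Omod23_iso.
- exact: Omod123_iso.
Qed.
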